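(* Let $\Lambda=\Bbbk Q/I$ be an admissible quotient of a path algebra of a finite quiver $Q$ over a field $\Bbbk$, let $H=H(Q)$ be its homological heart, and let $e$ and $e^-$ be the sums of the vertex idempotents corresponding to $H_0$ and $H_0^-$, respectively. If $\operatorname{pd}_{e\Lambda e}(e^-\Lambda e)<\infty$ (as a right $e\Lambda e$-module), then, for every $k\ge1$, $$k\text{-}\operatorname{ddell}\Lambda<\infty\quad\Longleftrightarrow\quad k\text{-}\operatorname{ddell}(e\Lambda e)<\infty.$$
   Context: Modules are finitely generated right modules; paths are composed from left to right. Let $X$ be the set of vertices of $Q$ lying on a nontrivial oriented cycle in $Q$, and let $Y$ be the set of vertices of $Q$ lying on a path whose initial and terminal vertices belong to $X$. The homological heart $H=H(Q)$ is the full subquiver of $Q$ with vertex set $H_0=Y$. Further, $H_0^-=\{v\in Q_0\setminus H_0\mid$ there exists a path from $v$ to a vertex of $H_0\}$. For a finite-dimensional algebra $\Lambda$, $\Omega$ denotes the syzygy endofunctor of the stable category of $\operatorname{mod}\text{-}\Lambda$ (modulo morphisms factoring through projectives), $\Omega^0=\operatorname{id}$; $U$ is a stable retract of $V$ if it is a retract of $V$ in this stable category. For $k\ge1$ and $X\in\operatorname{mod}\text{-}\Lambda$ (with $\inf\emptyset=\infty$): - $k\text{-}\operatorname{dell}_\Lambda X=\inf\{n\ge0\mid \Omega^nX$ is a stable retract of $\Omega^{n+k}Y$ for some $Y\}$; - $k\text{-}\operatorname{ddell}_\Lambda X=\inf\{m\ge0\mid$ there exist $0\le t\le m$ and an exact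 sequence $0\to C_t\to\cdots\to C_0\to X\to0$ with $(i+k)\text{-}\operatorname{dell}_\Lambda C_i\le m-i$ for $0\le i\le t\}$. $k\text{-}\operatorname{ddell}\Lambda=\sup\{k\text{-}\operatorname{ddell}_\Lambda S\mid S$ a simple right $\Lambda$-module$\}$. *)

(* Defs.v *)
From HB Require Import structures.
From mathcomp Require Import all_boot all_algebra.
From mathcomp Require Import finmap boolp.
From mathcomp.multinomials Require Import monalg.

Set Implicit Arguments.
Unset Strict Implicit.
Unset Printing Implicit Defensive.

Import GRing.Theory.

Local Open Scope ring_scope.

Variant enat := Fin of nat | Infty.

Definition le_enat (x y : enat) : bool :=
  match x, y with
  | _, Infty => true
  | Infty, Fin _ => false
  | Fin m, Fin n => (m <= n)%N
  end.

Definition finite_enat (x : enat) : bool := if x is Fin _ then true else false.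

(* The infimum in enat of a set of naturals; it is Infty for the empty set. *)
Definition inf_enat (A : nat -> Prop) : enat :=
  if pselect (exists n, `[< A n >]) is left exA then Fin (ex_minn exA)
  else Infty.

(* The least upper bound in enat; in particular sup of the empty set = 0. *)
Definition sup_enat (A : enat -> Prop) : enat :=
  inf_enat (fun m => forall a, A a -> le_enat a (Fin m)).

(* A right R-module is a left module over the converse ring, so that
   [r *: x] stands for the usual [x r]. *)
Notation rmodType R := (lmodType R^c).

Definition fin_gen (R : pzRingType) (M : rmodType R) : Prop :=
  exists (n : nat) (g : 'I_n -> M),
    forall x : M, exists c : 'I_n -> R^c, x = \sum_i c i *: g i.

Record modr (R : pzRingType) := Modr {
  modr_sort :> rmodType R;
  modr_fin_gen : fin_gen modr_sort
}.

Section Modules.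
Variable R : pzRingType.

Definition surj (U V : Type) (f : U -> V) : Prop := forall y, exists x, f x = y.

Definition exact_at (U V W : rmodType R) (f : U -> V) (g : V -> W) : Prop :=
  forall y, g y = 0 <-> exists x, f x = y.

Definition projective (P : rmodType R) : Prop :=
  forall (M N : rmodType R) (f : {linear M -> N}) (g : {linear P -> N}),
    surj f -> exists h : {linear P -> M}, forall x, f (h x) = g x.

Definition simple_module (S : rmodType R) : Prop :=
  (exists x : S, x != 0) /\
  forall V : {pred S}, submod_closed V -> (V =i pred1 0) \/ (V =i predT).

(* 0 -> C t -> ... -> C 0 -> X -> 0 is exact for suitable maps; the sequence
   is extended by C i = 0 for i > t. *)
Definition exact_resolution (t : nat) (C : nat -> modr R) (X : rmodType R)
    : Prop :=
  exists (d : forall i, {linear C i.+1 -> C i}) (a : {linear C 0%N -> X}),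
    [/\ surj a, exact_at (d 0%N) a,
        forall i, exact_at (d i.+1) (d i)
      & forall i, (t < i)%N -> forall x : C i, x = 0].

Definition pd (X : rmodType R) : enat :=
  inf_enat (fun n => exists C : nat -> modr R,
    (forall i, (i <= n)%N -> projective (C i)) /\ exact_resolution n C X).

Definition stable_eq (U V : modr R) (f g : {linear U -> V}) : Prop :=
  exists (P : modr R) (a : {linear U -> P}) (b : {linear P -> V}),
    projective P /\ forall x, f x - g x = b (a x).

Definition stable_retract (U V : modr R) : Prop :=
  exists (f : {linear U -> V}) (g : {linear V -> U}),
    stable_eq (g \o f) idfun.

(* K is the kernel of an epimorphism onto X from a finitely generated
   projective module.  By Schanuel's lemma this determines K up to isomorphism
   in the stable category, i.e., K represents the object Omega X. *)
Definition is_syzygy (X K : modr R) : Prop :=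
  exists (P : modr R) (i : {linear K -> P}) (p : {linear P -> X}),
    [/\ projective P, injective i, exact_at i p & surj p].

(* [syzygy n X K]: K represents the object Omega^n X of the stable category. *)
Inductive syzygy : nat -> modr R -> modr R -> Prop :=
| Syzygy0 X : syzygy 0 X X
| SyzygyS n X K L : syzygy n X K -> is_syzygy K L -> syzygy n.+1 X L.

Definition dell (k : nat) (X : modr R) : enat :=
  inf_enat (fun n => exists Y K L : modr R,
    [/\ syzygy n X K, syzygy (n + k) Y L & stable_retract K L]).

Definition ddell (k : nat) (X : modr R) : enat :=
  inf_enat (fun m => exists (t : nat) (C : nat -> modr R),
    [/\ (t <= m)%N, exact_resolution t C X
      & forall i, (i <= t)%N -> le_enat (dell (i + k) (C i)) (Fin (m - i))]).

End Modules.

Definition ddell_alg (k : nat) (R : pzRingType) : enat :=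
  sup_enat (fun a => exists S : modr R, simple_module S /\ a = ddell k S).

HB.mixin Record isTwoSided (R : pzRingType) (S : R -> bool) := {
  two_sided_subproof :
    forall a x : R, x \in S -> (a * x \in S) /\ (x * a \in S)
}.

#[short(type="ideal")]
HB.structure Definition Ideal (R : pzRingType) :=
  {S of GRing.ZmodClosed R S & isTwoSided R S}.

Definition ideal_gen (R : pzRingType) (G : R -> Prop) (x : R) : Prop :=
  forall I : ideal R, (forall y, G y -> y \in I) -> x \in I.

Fixpoint ideal_pow (R : pzRingType) (J : R -> Prop) (n : nat) : R -> Prop :=
  if n is m.+1 then
    ideal_gen (fun z => exists x y, [/\ J x, ideal_pow J m y & z = x * y])
  else fun=> True.

(* MathComp equips {ideal_quot I} with a ring structure only for commutative
   rings, so the multiplication is constructed here. *)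
Definition quot_ring (R : pzRingType) (I : ideal R) : Type :=
  {ideal_quot I}.

Section QuotRing.
Variables (R : pzRingType) (I : ideal R).
Local Open Scope quotient_scope.
Local Notation Q := {ideal_quot I}.

Definition quot_one : Q := \pi_Q 1.
Definition quot_mul (x y : Q) : Q := \pi_Q (repr x * repr y).

Lemma quot_piM (x y : R) : \pi_Q (x * y) = quot_mul (\pi_Q x) (\pi_Q y).
Proof.
apply/eqP; rewrite -Quotient.idealrBE.
set x' := repr _; set y' := repr _.
have Ix : x - x' \in I by rewrite Quotient.idealrBE reprK.
have Iy : y - y' \in I by rewrite Quotient.idealrBE reprK.
have IM := @two_sided_subproof R I.
rewrite -[x * y](addrNK (x * y')) -mulrBr -addrA -mulrBl.
apply: rpredD; first by have [] := IM x _ Iy.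
by have [] := IM y' _ Ix.
Qed.

Lemma quot_mulA : associative quot_mul.
Proof.
elim/quotW=> x; elim/quotW=> y; elim/quotW=> z.
by rewrite -(quot_piM y) -(quot_piM x y) -(quot_piM x) -(quot_piM _ z) mulrA.
Qed.

Lemma quot_mul1 : left_id quot_one quot_mul.
Proof. by elim/quotW=> x; rewrite -(quot_piM 1) mul1r. Qed.

Lemma quot_mulr1 : right_id quot_one quot_mul.
Proof. by elim/quotW=> x; rewrite -(quot_piM _ 1) mulr1. Qed.

Lemma quot_mulDl : left_distributive quot_mul +%R.
Proof.
elim/quotW=> x; elim/quotW=> y; elim/quotW=> z.
by rewrite -(quot_piM x) -(quot_piM y) -!raddfD -(quot_piM _ z) mulrDl.
Qed.

Lemma quot_mulDr : right_distributive quot_mul +%R.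
Proof.
elim/quotW=> x; elim/quotW=> y; elim/quotW=> z.
by rewrite -(quot_piM _ y) -(quot_piM _ z) -!raddfD -(quot_piM x) mulrDr.
Qed.

HB.instance Definition _ := GRing.Zmodule.copy (quot_ring I) Q.
HB.instance Definition _ := GRing.Zmodule_isPzRing.Build (quot_ring I)
  quot_mulA quot_mul1 quot_mulr1 quot_mulDl quot_mulDr.

Definition quot_proj (x : R) : quot_ring I := \pi_Q x.

Lemma quot_proj_is_zmod_morphism : zmod_morphism quot_proj.
Proof. exact: raddfB. Qed.

Lemma quot_proj_is_monoid_morphism : monoid_morphism quot_proj.
Proof. by split=> // x y; rewrite /quot_proj quot_piM. Qed.

HB.instance Definition _ := GRing.isZmodMorphism.Build R (quot_ring I) quot_proj
  quot_proj_is_zmod_morphism.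
HB.instance Definition _ := GRing.isMonoidMorphism.Build R (quot_ring I) quot_proj
  quot_proj_is_monoid_morphism.

End QuotRing.

Record quiver := Quiver {
  vertex : finType;
  arrow : finType;
  src : arrow -> vertex;
  tgt : arrow -> vertex
}.

Section Paths.
Variable Q : quiver.

Fixpoint is_walk (v : vertex Q) (s : seq (arrow Q)) : bool :=
  if s is a :: s' then (src a == v) && is_walk (tgt a) s' else true.

(* A path is its initial vertex together with its sequence of arrows in the
   order of traversal; the paths of length 0 are the vertices. *)
Record qpath := QPath {
  qpath_val : vertex Q * seq (arrow Q);
  qpathP : is_walk qpath_val.1 qpath_val.2
}.

HB.instance Definition _ := [isSub for qpath_val].
HB.instance Definition _ := [Countable of qpath by <:].

Definition psrc (p : qpath) : vertex Q := (val p).1.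
Definition parrows (p : qpath) : seq (arrow Q) := (val p).2.
Definition plen (p : qpath) : nat := size (parrows p).
Definition pverts (p : qpath) : seq (vertex Q) :=
  psrc p :: map (@tgt Q) (parrows p).
Definition ptgt (p : qpath) : vertex Q := last (psrc p) (map (@tgt Q) (parrows p)).

Definition ptriv (v : vertex Q) : qpath := @QPath (v, [::]) isT.

Lemma parrow_subproof (a : arrow Q) : is_walk (src a) [:: a].
Proof. by rewrite /= eqxx. Qed.
Definition parrow (a : arrow Q) : qpath :=
  @QPath (src a, [:: a]) (parrow_subproof a).

Lemma is_walk_cat v s1 s2 :
  is_walk v (s1 ++ s2)
  = is_walk v s1 && is_walk (last v (map (@tgt Q) s1)) s2.
Proof. by elim: s1 v => //= a s1 IHs v; rewrite IHs andbA. Qed.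

(* Paths are composed from left to right: [pcomp p q] is p followed by q. *)
Definition pcomp (p q : qpath) : option qpath :=
  if ptgt p == psrc q then insub (psrc p, parrows p ++ parrows q) else None.

Lemma pcomp_some p q : ptgt p = psrc q ->
  exists r, [/\ pcomp p q = Some r, psrc r = psrc p, ptgt r = ptgt q
              & parrows r = parrows p ++ parrows q].
Proof.
move=> pq; rewrite /pcomp pq eqxx.
have w : is_walk (psrc p) (parrows p ++ parrows q).
  rewrite is_walk_cat (qpathP p) /=.
  by rewrite -[last _ _]/(ptgt p) pq; apply: (qpathP q).
rewrite insubT; eexists; split; first by [].
- by rewrite /psrc SubK.
- by rewrite /ptgt /psrc /parrows SubK /= map_cat last_cat -/(ptgt p) pq.
- by rewrite /parrows SubK.
Qed.

Lemma pcomp_none p q : ptgt p <> psrc q -> pcomp p q = None.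
Proof. by rewrite /pcomp => /eqP/negPf->. Qed.

Lemma qpath_eq p q : psrc p = psrc q -> parrows p = parrows q -> p = q.
Proof.
by move=> e1 e2; apply: val_inj; rewrite [LHS]surjective_pairing
  [RHS]surjective_pairing; congr (_, _).
Qed.

Lemma pcompA p q r :
  obind (pcomp^~ r) (pcomp p q) = obind (pcomp p) (pcomp q r).
Proof.
have [pq|npq] := eqVneq (ptgt p) (psrc q); last first.
  rewrite (pcomp_none (elimN eqP npq)) /=.
  have [qr|nqr] := eqVneq (ptgt q) (psrc r); last first.
    by rewrite (pcomp_none (elimN eqP nqr)).
  have [t [-> ts _ _]] := pcomp_some qr.
  by rewrite /= pcomp_none // ts; apply/eqP.
have [t [-> ts tt ta]] := pcomp_some pq; rewrite /=.
have [qr|nqr] := eqVneq (ptgt q) (psrc r); last first.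
  by rewrite (pcomp_none (elimN eqP nqr)) pcomp_none // tt; apply/eqP.
have [u [-> us ut ua]] := pcomp_some qr; rewrite /=.
have [|w [-> ws _ wa]] := @pcomp_some t r; first by rewrite tt.
have [|w' [-> ws' _ wa']] := @pcomp_some p u; first by rewrite us.
congr Some; apply: qpath_eq; first by rewrite ws ws'.
by rewrite wa wa' ta ua catA.
Qed.

Lemma pcomp1p v p : pcomp (ptriv v) p = if v == psrc p then Some p else None.
Proof.
have [pq|npq] := eqVneq v (psrc p); last by rewrite pcomp_none //; apply/eqP.
have [|r [-> rs _ ra]] := @pcomp_some (ptriv v) p; first by [].
by congr Some; apply: qpath_eq; rewrite ?rs ?ra.
Qed.

Lemma pcompp1 v p : pcomp p (ptriv v) = if v == ptgt p then Some p else None.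
Proof.
have [pq|npq] := eqVneq v (ptgt p); last first.
  by rewrite pcomp_none // => /esym; apply/eqP.
have [|r [-> rs _ ra]] := @pcomp_some p (ptriv v); first by [].
by congr Some; apply: qpath_eq; rewrite ?rs ?ra //= cats0.
Qed.

Definition on_cycle (v : vertex Q) : Prop :=
  exists p : qpath, [/\ (0 < plen p)%N, psrc p = ptgt p & v \in pverts p].

(* The homological heart is the full subquiver on this set of vertices; only
   the vertices enter the statement. *)
Definition heart : {set vertex Q} :=
  [set v | `[< exists p : qpath,
    [/\ on_cycle (psrc p), on_cycle (ptgt p) & v \in pverts p] >]].

Definition heart_minus : {set vertex Q} :=
  [set v | (v \notin heart) &&
    `[< exists p : qpath, psrc p = v /\ ptgt p \in heart >]].

End Paths.

(* An alias of {malg K[qpath Q]}: the product of paths is only partially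
   defined, so this is not a monoid algebra. *)
Definition path_alg (K : fieldType) (Q : quiver) : Type := {malg K[qpath Q]}.

Section PathAlg.
Variables (K : fieldType) (Q : quiver).
Local Notation A := (path_alg K Q).

HB.instance Definition _ := GRing.Lmodule.copy A {malg K[qpath Q]}.

Definition pelt (p : qpath Q) : A := << p >>.

Definition pelt_mul (p q : qpath Q) : A :=
  if pcomp p q is Some r then pelt r else 0.

Definition path_one : A := \sum_(v : vertex Q) pelt (ptriv v).

Definition path_mul (x y : A) : A :=
  \sum_(p <- msupp x) \sum_(q <- msupp y) (x@_p * y@_q) *: pelt_mul p q.

Definition pext (V : lmodType K) (h : qpath Q -> V) (x : A) : V :=
  \sum_(p <- msupp x) x@_p *: h p.

Lemma pextw (V : lmodType K) (h : qpath Q -> V) (x : A) (d : {fset qpath Q}) :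
  (msupp x `<=` d)%fset -> pext h x = \sum_(p <- d) x@_p *: h p.
Proof.
move=> sxd; rewrite /pext (big_fset_incl _ sxd) // => p _ /mcoeff_outdom->.
by rewrite scale0r.
Qed.

Lemma pext_is_linear (V : lmodType K) (h : qpath Q -> V) : linear (pext h).
Proof.
move=> c x y; pose d := (msupp x `|` msupp y `|` msupp (c *: x + y))%fset.
rewrite (@pextw _ h x d) ?(@pextw _ h y d) ?(@pextw _ h _ d); first last.
- by rewrite /d -fsetUA fsubsetUl.
- by rewrite /d fsetUAC fsubsetUr.
- by rewrite /d fsubsetUr.
rewrite scaler_sumr -big_split /=; apply: eq_bigr => p _.
by rewrite mcoeffD mcoeffZ scalerDl scalerA.
Qed.

HB.instance Definition _ (V : lmodType K) (h : qpath Q -> V) :=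
  GRing.isLinear.Build K A V *:%R (pext h) (pext_is_linear h).

Lemma pextU (V : lmodType K) (h : qpath Q -> V) p : pext h (pelt p) = h p.
Proof.
rewrite /pext /pelt msuppU oner_eq0 big_seq_fset1.
by rewrite mcoeffUU scale1r.
Qed.

Lemma pelt_span (x : A) : x = \sum_(p <- msupp x) x@_p *: pelt p.
Proof.
rewrite {1}[x]monalgE; apply: eq_bigr => p _; apply/malgP => q.
by rewrite mcoeffZ !mcoeffU mulr_natr.
Qed.

Lemma plin_ind (V : lmodType K) (f g : {linear A -> V}) :
  (forall p, f (pelt p) = g (pelt p)) -> f =1 g.
Proof.
move=> fg x; rewrite [x]pelt_span !linear_sum; apply: eq_bigr => p _.
by rewrite !linearZ fg.
Qed.

Lemma path_mulE x y : path_mul x y = pext (fun p => pext (pelt_mul p) y) x.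
Proof.
rewrite /path_mul /pext; apply: eq_bigr => p _.
by rewrite scaler_sumr; apply: eq_bigr => q _; rewrite scalerA.
Qed.

Lemma path_mulr_linear x : linear (path_mul x).
Proof.
move=> c y z; rewrite !path_mulE /pext scaler_sumr -big_split /=.
apply: eq_bigr => p _; rewrite -/(pext _ _) linearP scalerDr.
by rewrite !scalerA [c * _]mulrC.
Qed.

Lemma path_mull_linear y : linear (path_mul^~ y).
Proof. by move=> c x z /=; rewrite !path_mulE linearP. Qed.

HB.instance Definition _ x :=
  GRing.isLinear.Build K A A *:%R (path_mul x) (path_mulr_linear x).

Definition path_mulr (y x : A) : A := path_mul x y.
HB.instance Definition _ y :=
  GRing.isLinear.Build K A A *:%R (path_mulr y) (path_mull_linear y).

Lemma path_mulU p q : path_mul (pelt p) (pelt q) = pelt_mul p q.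
Proof. by rewrite path_mulE !pextU. Qed.

Lemma path_mulA : associative path_mul.
Proof.
move=> x y z.
suff e p q r : path_mul (pelt p) (path_mul (pelt q) (pelt r))
             = path_mul (path_mul (pelt p) (pelt q)) (pelt r).
  have e1 p q : path_mul (pelt p) (path_mul (pelt q) z)
              = path_mul (path_mul (pelt p) (pelt q)) z.
    apply: (plin_ind (f := path_mul (pelt p) \o path_mul (pelt q))
      (g := path_mul (path_mul (pelt p) (pelt q)))).
    by move=> r; exact: e.
  have e2 p : path_mul (pelt p) (path_mul y z)
            = path_mul (path_mul (pelt p) y) z.
    apply: (plin_ind (f := path_mul (pelt p) \o path_mulr z)
      (g := path_mulr z \o path_mul (pelt p))).
    by move=> q; exact: e1.
  apply: (plin_ind (f := path_mulr (path_mul y z))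
    (g := path_mulr z \o path_mulr y)).
  by move=> p; exact: e2.
rewrite !path_mulU /pelt_mul.
transitivity (if obind (pcomp p) (pcomp q r) is Some t then pelt t else 0).
  by case: (pcomp q r) => [t|]; rewrite ?linear0 //= path_mulU.
rewrite -pcompA; case: (pcomp p q) => [t|] /=; first by rewrite path_mulU.
by rewrite -[LHS](linear0 (path_mulr (pelt r))).
Qed.

Lemma path_mul1 : left_id path_one path_mul.
Proof.
apply: (plin_ind (f := path_mul path_one) (g := idfun)) => p /=.
rewrite -[LHS]/(path_mulr (pelt p) path_one) /path_one linear_sum.
rewrite (bigD1 (psrc p)) //= big1 => [|v ne]; rewrite /path_mulr path_mulU
  /pelt_mul pcomp1p ?eqxx ?addr0 //.
by rewrite (negPf ne).
Qed.

Lemma path_mulr1 : right_id path_one path_mul.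
Proof.
apply: (plin_ind (f := path_mulr path_one) (g := idfun)) => p /=.
rewrite /path_mulr /path_one linear_sum.
rewrite (bigD1 (ptgt p)) //= big1 => [|v ne]; rewrite path_mulU
  /pelt_mul pcompp1 ?eqxx ?addr0 //.
by rewrite (negPf ne).
Qed.

Lemma path_mulDl : left_distributive path_mul +%R.
Proof. by move=> x y z; exact: (linearD (path_mulr z)). Qed.

Lemma path_mulDr : right_distributive path_mul +%R.
Proof. by move=> x y z; exact: linearD. Qed.

HB.instance Definition _ := GRing.Zmodule_isPzRing.Build A
  path_mulA path_mul1 path_mulr1 path_mulDl path_mulDr.

Definition arrow_ideal : A -> Prop :=
  ideal_gen (fun x => exists a : arrow Q, x = pelt (parrow a)).

Definition admissible (I : ideal A) : Prop :=
  exists m : nat, [/\ (2 <= m)%N,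
    forall x, ideal_pow arrow_ideal m x -> x \in I
  & forall x, x \in I -> ideal_pow arrow_ideal 2 x].

End PathAlg.

Record idem (R : pzRingType) := Idem {
  idem_val :> R;
  idemP : idem_val * idem_val = idem_val
}.

Section VertexIdem.
Variables (K : fieldType) (Q : quiver) (I : ideal (path_alg K Q)).

Definition vertex_sum (S : {set vertex Q}) : quot_ring I :=
  \sum_(v in S) quot_proj I (pelt K (ptriv v)).

Lemma vertex_sum_idem S : vertex_sum S * vertex_sum S = vertex_sum S.
Proof.
rewrite /vertex_sum mulr_suml; apply: eq_bigr => v Sv.
rewrite mulr_sumr (bigD1 v) //= big1 => [|w /andP[_ ne]].
  rewrite addr0 -rmorphM; congr quot_proj.
  by rewrite -[LHS]/(path_mul _ _) path_mulU /pelt_mul pcomp1p eqxx.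
rewrite -rmorphM -[RHS](rmorph0 (quot_proj I)); congr quot_proj.
rewrite -[LHS]/(path_mul _ _) path_mulU /pelt_mul pcomp1p eq_sym.
by rewrite (negPf ne).
Qed.

Definition vertex_idem (S : {set vertex Q}) : idem (quot_ring I) :=
  Idem (vertex_sum_idem S).

End VertexIdem.

Section Peirce.
Variable R : pzRingType.

Definition peirce_pred (f e : idem R) : {pred R} := fun x => (f : R) * x * (e : R) == x.

Lemma in_peirce f e x :
  (x \in peirce_pred f e) = ((f : R) * x * (e : R) == x).
Proof. by []. Qed.

Lemma peirce_pred_zmod_closed f e : zmod_closed (peirce_pred f e).
Proof.
split; first by rewrite in_peirce mulr0 mul0r.
move=> x y; rewrite !in_peirce => /eqP xE /eqP yE.
by rewrite mulrBr mulrBl xE yE.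
Qed.

HB.instance Definition _ f e :=
  GRing.isZmodClosed.Build R (peirce_pred f e) (peirce_pred_zmod_closed f e).

(* f R e, as the set of x with f x e = x.  The aliases [corner] and
   [peirce_mod] below carry its structures of ring (for f = e) and of right
   e R e-module. *)
Record peirce (f e : idem R) := Peirce {
  peirce_val :> R;
  peirceP : peirce_val \in peirce_pred f e
}.

HB.instance Definition _ f e := [isSub for @peirce_val f e].
HB.instance Definition _ f e := [Choice of peirce f e by <:].
HB.instance Definition _ f e :=
  [SubChoice_isSubZmodule of peirce f e by <:].

Lemma peirceE f e (x : peirce f e) : (f : R) * (x : R) * (e : R) = (x : R).
Proof. exact/eqP/(peirceP x). Qed.

Lemma peirce_l f e (x : peirce f e) : (f : R) * (x : R) = (x : R).
Proof. by rewrite -[in LHS]peirceE -[in RHS]peirceE !mulrA idemP. Qed.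

Lemma peirce_r f e (x : peirce f e) : (x : R) * (e : R) = (x : R).
Proof. by rewrite -[in LHS]peirceE -[in RHS]peirceE -!mulrA idemP. Qed.

Lemma peirce_mul_subproof f e g (x : peirce f e) (y : peirce e g) :
  (x : R) * (y : R) \in peirce_pred f g.
Proof. by rewrite in_peirce mulrA peirce_l -mulrA peirce_r. Qed.

Definition peirce_mul f e g (x : peirce f e) (y : peirce e g) : peirce f g :=
  Peirce (peirce_mul_subproof x y).

Lemma corner_one_subproof (e : idem R) : (e : R) \in peirce_pred e e.
Proof. by rewrite in_peirce !idemP. Qed.

Definition corner (e : idem R) : Type := peirce e e.

Section CornerRing.
Variable e : idem R.
Definition corner_one : peirce e e := Peirce (corner_one_subproof e).

Lemma corner_mulA : associative (@peirce_mul e e e).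
Proof. by move=> x y z; apply: val_inj; rewrite /= mulrA. Qed.
Lemma corner_mul1 : left_id corner_one (@peirce_mul e e e).
Proof. by move=> x; apply: val_inj; rewrite /= peirce_l. Qed.
Lemma corner_mulr1 : right_id corner_one (@peirce_mul e e e).
Proof. by move=> x; apply: val_inj; rewrite /= peirce_r. Qed.
Lemma corner_mulDl : left_distributive (@peirce_mul e e e) +%R.
Proof. by move=> x y z; apply: val_inj; rewrite /= mulrDl. Qed.
Lemma corner_mulDr : right_distributive (@peirce_mul e e e) +%R.
Proof. by move=> x y z; apply: val_inj; rewrite /= mulrDr. Qed.

HB.instance Definition _ := GRing.Zmodule.copy (corner e) (peirce e e).
HB.instance Definition _ := GRing.Zmodule_isPzRing.Build (corner e)
  corner_mulA corner_mul1 corner_mulr1 corner_mulDl corner_mulDr.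
End CornerRing.

Definition peirce_mod (f e : idem R) : Type := peirce f e.

Section PeirceMod.
Variables f e : idem R.

Definition peirce_act (r : (corner e)^c) (x : peirce f e) : peirce f e :=
  peirce_mul x (r : peirce e e).

Lemma peirce_actA r s x : peirce_act r (peirce_act s x) = peirce_act (r * s) x.
Proof. by apply: val_inj; rewrite /= -mulrA. Qed.
Lemma peirce_act1 : left_id 1 peirce_act.
Proof. by move=> x; apply: val_inj; rewrite /= peirce_r. Qed.
Lemma peirce_actDr : right_distributive peirce_act +%R.
Proof. by move=> r x y; apply: val_inj; rewrite /= mulrDl. Qed.
Lemma peirce_actDl x : {morph peirce_act^~ x : r s / r + s}.
Proof. by move=> r s; apply: val_inj; rewrite /= mulrDr. Qed.

HB.instance Definition _ := GRing.Zmodule.copy (peirce_mod f e) (peirce f e).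
HB.instance Definition _ := GRing.Zmodule_isLmodule.Build (corner e)^c
  (peirce_mod f e) peirce_actA peirce_act1 peirce_actDr peirce_actDl.
End PeirceMod.

End Peirce.

(* Main.v *)
(* Write e-, e, e+ for the sums of the vertex idempotents over H^-, H and the
   remaining vertices.  Then e L e- = e+ L e = e+ L e- = 0 for L = kQ/I, and no
   oriented cycle meets H^- or the remaining vertices.  Hence x |-> e x e is a
   ring epimorphism L -> e L e.  Inflation along it, G : mod-eLe -> mod-L, and
   restriction F = (-)e : mod-L -> mod-eLe are exact, and both send projectives
   to modules of bounded projective dimension d: for G because 0 -> e L e+ ->
   e L -> e L e -> 0 is exact and modules living on e+ have finite projective
   dimension, for F because F L = e- L e + e L e.  For such a functor,
   Omega^d (F (Omega^n X)) and Omega^(d+n) (F X) are stably equivalent, so F and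
   G raise k-ddell by at most d.  Since F (G T) = T, this bounds k-ddell of the
   simple e L e-modules, and of the simple L-modules living on H.  The other
   simple L-modules live on e+ or e- and have bounded projective dimension; for
   e- one inflates from e- L e-, which has finite global dimension and is, as an
   L-module, a quotient of e- L by an extension of e- L e by a module living on
   e+. *)

Require Import Defs.
From HB Require Import structures.
From mathcomp Require Import all_boot all_algebra.
From mathcomp Require Import boolp.
From mathcomp.multinomials Require Import monalg.

Set Implicit Arguments.
Unset Strict Implicit.
Unset Printing Implicit Defensive.

Import GRing.Theory.
Local Open Scope ring_scope.


(** * Modules and stable retracts *)

Definition mklin (R : pzRingType) (U V : rmodType R) (f : U -> V)
    (fL : linear f) : {linear U -> V} :=
  HB.pack f (GRing.isLinear.Build R^c U V *:%R f fL).

Section Kernel.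
Variables (R : pzRingType) (U V : rmodType R) (f : {linear U -> V}).

Definition ker_pred : {pred U} := fun x => f x == 0.

Lemma ker_pred_submod : submod_closed ker_pred.
Proof.
split; first by rewrite unfold_in linear0.
by move=> a x y; rewrite !unfold_in linearP => /eqP-> /eqP->; rewrite scaler0 addr0.
Qed.

HB.instance Definition _ :=
  GRing.isSubmodClosed.Build R^c U ker_pred ker_pred_submod.

Record ker := Ker { ker_val :> U; kerP : ker_val \in ker_pred }.

HB.instance Definition _ := [isSub for ker_val].
HB.instance Definition _ := [Choice of ker by <:].
HB.instance Definition _ := [SubChoice_isSubZmodule of ker by <:].
HB.instance Definition _ := [SubZmodule_isSubLmodule of ker by <:].

End Kernel.

(** * Finite generation and covers by powers of a right ideal *)

Section Generation.
Variable R : pzRingType.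
Implicit Types (U V W M : rmodType R).

Lemma fin_gen_surj U V (f : {linear U -> V}) : surj f -> fin_gen U -> fin_gen V.
Proof.
move=> f_surj [n [g gP]]; exists n, (f \o g) => y.
have [x <-] := f_surj y; have [c ->] := gP x; exists c.
by rewrite linear_sum; apply: eq_bigr => i _; rewrite linearZ.
Qed.

Lemma fin_gen_prod U V : fin_gen U -> fin_gen V -> fin_gen (U * V)%type.
Proof.
move=> [n [g gP]] [m [h hP]]; exists (n + m)%N.
exists (fun i => match split i with inl j => (g j, 0) | inr j => (0, h j) end).
move=> [x y]; have [c ->] := gP x; have [d ->] := hP y.
exists (fun i => match split i with inl j => c j | inr j => d j end).
rewrite big_split_ord /=.
have splitl i : split (lshift m i) = inl i by exact: (unsplitK (inl i)).
have splitr i : split (rshift n i) = inr i by exact: (unsplitK (inr i)).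
rewrite [X in _ = X + _](eq_bigr (fun i => c i *: (g i, 0))) => [|i _]; last by rewrite splitl.
rewrite [X in _ = _ + X](eq_bigr (fun i => d i *: (0, h i))) => [|i _]; last by rewrite splitr.
have fstS k (F : 'I_k -> (U * V)%type) : (\sum_i F i).1 = \sum_i (F i).1.
  exact: (big_morph (@fst U V)).
have sndS k (F : 'I_k -> (U * V)%type) : (\sum_i F i).2 = \sum_i (F i).2.
  exact: (big_morph (@snd U V)).
congr (_, _).
  rewrite -[RHS]/((\sum_(i < n) _).1 + (\sum_(i < m) _).1) !fstS /=.
  by rewrite [X in _ = _ + X]big1 ?addr0 // => i _; rewrite scaler0.
rewrite -[RHS]/((\sum_(i < n) _).2 + (\sum_(i < m) _).2) !sndS /=.
by rewrite [X in _ = X + _]big1 ?add0r // => i _; rewrite scaler0.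
Qed.

Lemma fin_gen_zero : fin_gen ('rV[R^c]_0 : rmodType R).
Proof. by exists 0, (fun=> 0) => x; exists (fun=> 0); rewrite big_ord0; apply/matrixP => i []. Qed.

Lemma fin_gen_ring : fin_gen (R^c^o : rmodType R).
Proof. by exists 1, (fun=> 1) => x; exists (fun=> x); rewrite big_ord1 /GRing.scale/= mulr1. Qed.

Definition zero_mod : modr R := Modr fin_gen_zero.
Definition ring_mod : modr R := Modr fin_gen_ring.
Definition prodm (U V : modr R) : modr R :=
  Modr (fin_gen_prod (modr_fin_gen U) (modr_fin_gen V)).

Lemma zero_modE (x : zero_mod) : x = 0.
Proof. by apply/matrixP => i []. Qed.

Fixpoint pow (V : modr R) (n : nat) : modr R :=
  if n is m.+1 then prodm V (pow V m) else zero_mod.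

(** Coefficients are peeled off one at a time, so that arguments about bases go by induction on [s].
    The set [D] has three uses: all of R for generation, a division ring a R a for bases, and the
    base field for dimension counts. *)
Fixpoint spanned M (D : R -> Prop) (s : seq M) (x : M) : Prop :=
  if s is y :: s' then exists d : R^c, D d /\ spanned D s' (x - d *: y) else x = 0.

Lemma fin_gen_spanned M :
  fin_gen M <-> exists s : seq M, forall x, spanned (fun=> True) s x.
Proof.
split=> [[n [g gP]]|[s sP]]; last first.
  exists (size s), (nth 0 s) => x; move: {sP}(sP x).
  elim: s x => [|y s IHs] x /=; first by move->; exists (fun=> 0); rewrite big_ord0.
  move=> [d [_ /IHs[c xE]]].
  exists (fun i => if unlift ord0 i is Some j then c j else d).
  rewrite big_ord_recl unlift_none /= -[LHS](subrK (d *: y)) addrC xE.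
  by congr (_ + _); apply: eq_bigr => i _; rewrite liftK.
exists [seq g i | i <- enum 'I_n] => x; have [c ->] := gP x.
elim: n g c {gP x} => [|n IHn] g c; first by rewrite big_ord0 (size0nil (size_enum_ord 0)).
rewrite enum_ordSl big_ord_recl /=; exists (c ord0); split=> //.
by rewrite addrAC subrr add0r -map_comp; apply: IHn.
Qed.

Section PowMap.
Variables (V : modr R) (i : {linear V -> R^c^o}) (M : rmodType R).

Lemma regular_linear (y : M) : linear (fun a : R^c^o => (a : R^c) *: y).
Proof. by move=> c a b; rewrite scalerDl scalerA. Qed.

Lemma powmap_linear n (y : M) (h : {linear pow V n -> M}) :
  linear (fun a : pow V n.+1 => (i a.1 : R^c) *: y + h a.2).
Proof.
move=> c a b; rewrite /= !linearP; set u := i a.1; set v := i b.1.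
by rewrite [LHS]/(_ + _) regular_linear scalerDr addrACA.
Qed.

(** With V viewed in R through [i], this sends (a_1, ..., a_n) to the sum of the y_j i(a_j). It is
    used for V = R and for V = a R. *)
Fixpoint powmap (s : seq M) : {linear pow V (size s) -> M} :=
  if s is y :: s' then mklin (powmap_linear y (powmap s')) else \0.
End PowMap.

Lemma powmap_surj M (s : seq M) x : spanned (fun=> True) s x ->
  exists a, powmap (V := ring_mod) idfun s a = x.
Proof.
elim: s x => [|y s IHs] x /=; first by move->; exists 0.
move=> [d [_ /IHs[a aE]]]; exists (d, a).
by rewrite /= aE addrC subrK.
Qed.

Lemma fin_gen_cover (X : modr R) :
  exists n (p : {linear pow ring_mod n -> X}), surj p.
Proof.
have [s sP] := (fin_gen_spanned X).1 (modr_fin_gen X).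
by exists (size s), (powmap (V := ring_mod) idfun s) => x; apply: powmap_surj.
Qed.

End Generation.

(** * Projective modules and retracts up to projective summands *)

Section Stable.
Variable R : pzRingType.
Implicit Types (X Y P : modr R).

Definition retr (U V : rmodType R) : Prop :=
  exists (f : {linear U -> V}) (g : {linear V -> U}), forall x, g (f x) = x.

Lemma proj_zero : projective (zero_mod R).
Proof.
move=> M N f g f_surj; exists \0 => x /=.
by rewrite (zero_modE x) !linear0.
Qed.

Lemma proj_ring : projective (ring_mod R).
Proof.
move=> M N f g f_surj; have [m mE] := f_surj (g 1).
by exists (mklin (regular_linear m)) => x /=; rewrite linearZ mE -linearZ /= /GRing.scale/= mulr1.
Qed.

Lemma fst_linear (U V : rmodType R) : linear (@fst U V).
Proof. by []. Qed.
Lemma snd_linear (U V : rmodType R) : linear (@snd U V).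
Proof. by []. Qed.
Lemma inl_linear (U V : rmodType R) : linear (fun x : U => (x, 0 : V)).
Proof. by move=> c x y; congr (_, _); rewrite [RHS]addr0 [RHS]scaler0. Qed.
Lemma inr_linear (U V : rmodType R) : linear (fun x : V => (0 : U, x)).
Proof. by move=> c x y; congr (_, _); rewrite [RHS]addr0 [RHS]scaler0. Qed.
Lemma copair_linear (U V W : rmodType R) (f : {linear U -> W}) (g : {linear V -> W}) :
  linear (fun x : U * V => f x.1 + g x.2).
Proof. by move=> c x y /=; rewrite !linearP scalerDr addrACA. Qed.
Lemma pair_linear (U V W : rmodType R) (f : {linear W -> U}) (g : {linear W -> V}) :
  linear (fun x => (f x, g x)).
Proof. by move=> c x y; rewrite !linearP. Qed.

Lemma proj_prod P P' : projective P -> projective P' -> projective (prodm P P').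
Proof.
move=> pP pP' M N f g f_surj.
have [h hE] := pP M N f (g \o mklin (@inl_linear P P')) f_surj.
have [h' hE'] := pP' M N f (g \o mklin (@inr_linear P P')) f_surj.
exists (mklin (copair_linear h h')) => x /=.
rewrite linearD hE hE' /= -linearD; congr (g _).
by rewrite [RHS]surjective_pairing; congr (_, _); rewrite /= ?addr0 ?add0r.
Qed.

Lemma proj_pow P n : projective P -> projective (pow P n).
Proof. by move=> pP; elim: n => [|n IHn]; [apply: proj_zero|apply: proj_prod]. Qed.

Lemma proj_retr (P Q : rmodType R) : projective P -> retr Q P -> projective Q.
Proof.
move=> pP [f [g gK]] M N p h p_surj.
have [k kE] := pP M N p (h \o g) p_surj.
by exists (k \o f) => x /=; rewrite kE /= gK.
Qed.

Lemma proj_split (U P : rmodType R) (p : {linear U -> P}) : projective P -> surj p ->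
  exists s : {linear P -> U}, forall x, p (s x) = x.
Proof. by move=> pP p_surj; have [s sE] := pP _ _ p idfun p_surj; exists s. Qed.

Lemma proj_free P : projective P -> exists n, retr P (pow (ring_mod R) n).
Proof.
move=> pP; have [n [p p_surj]] := fin_gen_cover P.
by have [s sE] := proj_split pP p_surj; exists n, s, p.
Qed.

Lemma sr_retr X Y : retr X Y -> stable_retract X Y.
Proof.
move=> [f [g gK]]; exists f, g, (zero_mod R), \0, \0; split; first exact: proj_zero.
by move=> x /=; rewrite gK subrr.
Qed.

Lemma sr_refl X : stable_retract X X.
Proof. by apply: sr_retr; exists idfun, idfun. Qed.

(** The defect g f - 1 = b a is absorbed by the summand P through the maps (f, a) and (g, -b).
    Conversely, the part of a retraction that passes through P is such a defect. *)
Lemma sr_prod X Y : stable_retract X Y <->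
  exists P, projective P /\ retr X (prodm Y P).
Proof.
split=> [[f [g [P [a [b [pP E]]]]]]|[P [pP [f [g gK]]]]].
  exists P; split=> //.
  exists (mklin (pair_linear f a)), (mklin (copair_linear g (b \o (-%R : {linear P -> P})))) => x /=.
  by rewrite linearN -E /= opprB addrC subrK.
exists (mklin (@fst_linear Y P) \o f), (g \o mklin (@inl_linear Y P)).
exists P, (mklin (@snd_linear Y P) \o f), ((-%R : {linear X -> X}) \o g \o mklin (@inr_linear Y P)).
split=> // x /=; rewrite -[X in _ - X]gK; apply/eqP.
rewrite subr_eq addrC -subr_eq opprK -linearD; apply/eqP; congr (g _).
by rewrite [RHS]surjective_pairing; congr (_, _); rewrite /= ?addr0 ?add0r.
Qed.

Lemma retr_trans (U V W : rmodType R) : retr U V -> retr V W -> retr U W.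
Proof.
move=> [f [g gK]] [f' [g' gK']]; exists (f' \o f), (g \o g') => x /=.
by rewrite gK' gK.
Qed.

Lemma sr_trans X Y Z : stable_retract X Y -> stable_retract Y Z -> stable_retract X Z.
Proof.
move=> /sr_prod[P [pP XY]] /sr_prod[P' [pP' [f [g gK]]]]; apply/sr_prod.
exists (prodm P' P); split; first exact: proj_prod.
apply: retr_trans XY _.
pose F := pair_linear (mklin (@fst_linear _ _) \o f \o mklin (@fst_linear Y P))
  (mklin (pair_linear (mklin (@snd_linear _ _) \o f \o mklin (@fst_linear Y P)) (mklin (@snd_linear Y P)))).
pose G := pair_linear
  (g \o mklin (pair_linear (mklin (@fst_linear Z (prodm P' P)))
                 (mklin (@fst_linear P' P) \o mklin (@snd_linear Z (prodm P' P)))))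
  (mklin (@snd_linear P' P) \o mklin (@snd_linear Z (prodm P' P))).
exists (mklin F), (mklin G) => x /=.
by rewrite -surjective_pairing gK -surjective_pairing.
Qed.

Lemma sr_proj X Y : projective Y -> stable_retract X Y -> projective X.
Proof. by move=> pY /sr_prod[P [pP XY]]; apply: proj_retr XY; apply: proj_prod. Qed.

Lemma proj_sr X Y : projective X -> stable_retract X Y.
Proof.
move=> pX; apply/sr_prod; exists X; split=> //.
by exists (mklin (@inr_linear Y X)), (mklin (@snd_linear Y X)).
Qed.

End Stable.

(** * Syzygies *)

(** Submodules are given by embeddings, so that the kernel of a map out of a [modr] can itself be
    bundled as a [modr]; this makes syzygies exist. *)
Definition noetherian (R : pzRingType) : Prop :=
  forall (X : modr R) (M : rmodType R) (i : {linear M -> X}),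
    injective i -> fin_gen M.

Section Syzygies.
Variable R : pzRingType.
Implicit Types (X Y A B C P K L U V W : modr R).

Lemma lift_through (K P Q : rmodType R) (i : {linear K -> P}) (h : {linear Q -> P}) :
  injective i -> (forall x, exists k, i k = h x) ->
  exists s : {linear Q -> K}, forall x, i (s x) = h x.
Proof.
move=> i_inj /(@choice _ _ (fun x k => i k = h x))[s sE].
have sL : linear s by move=> c x y; apply: i_inj; rewrite linearP !sE linearP.
by exists (mklin sL).
Qed.

(** A relative Schanuel lemma: lifts of f and g to P and P' restrict to the kernels, where their
    defect factors through [i]. For X = X' it says that a syzygy is unique up to stable retracts in
    both directions. *)
Lemma is_syzygy_sr X X' K K' : is_syzygy X K -> is_syzygy X' K' ->
  stable_retract X X' -> stable_retract K K'.
Proof.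
move=> [P [i [p [pP i_inj ip p_surj]]]] [P' [i' [p' [pP' i'_inj ip' p'_surj]]]].
move=> [f [g [Q [a [b [pQ gfE]]]]]].
have [F FE] := pP _ _ p' (f \o p) p'_surj.
have [G GE] := pP' _ _ p (g \o p') p_surj.
have [B BE] := pQ _ _ p b p_surj.
have pi k : p (i k) = 0 by apply/ip; exists k.
have pi' k : p' (i' k) = 0 by apply/ip'; exists k.
have [|phi phiE] := lift_through (h := F \o i) i'_inj.
  by move=> k; apply/ip'; rewrite /= FE /= pi linear0.
have [|gam gamE] := lift_through (h := G \o i') i_inj.
  by move=> k; apply/ip; rewrite /= GE /= pi' linear0.
(* As p (G F - 1) = (g f - 1) p = b a p, subtracting the lift B a p lands in K. On K this correction
   vanishes because p i = 0. *)
have [|s sE] := lift_through (h := (G \o F \- idfun) \- (B \o a \o p)) i_inj.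
  move=> x; apply/ip; rewrite /= !linearB GE /= FE BE /= -gfE /=.
  by rewrite subrr.
exists phi, gam, P, i, s; split=> // k; apply: i_inj.
by rewrite linearB gamE /= phiE sE /= pi !linear0 addr0.
Qed.

Lemma syzygy_inv n X L : syzygy n X L ->
  if n is m.+1 then exists2 K, syzygy m X K & is_syzygy K L else X = L.
Proof. by case=> // {}n {}X K {}L XK KL; exists K. Qed.

Lemma syzygy_sr n X X' K K' : syzygy n X K -> syzygy n X' K' ->
  stable_retract X X' -> stable_retract K K'.
Proof.
elim: n K K' => [|n IHn] K K' /syzygy_inv; first by move=> <- /syzygy_inv <-.
move=> [L XL LK] /syzygy_inv[L' XL' LK'] XX'.
by apply: is_syzygy_sr LK LK' _; apply: IHn XL XL' XX'.
Qed.

Lemma syzygy_add m n X K L :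
  syzygy m X K -> syzygy n K L -> syzygy (n + m) X L.
Proof.
move=> XK; elim: n L => [|n IHn] L /syzygy_inv; first by move=> <-.
by move=> [L' /IHn XL' L'L]; apply: SyzygyS XL' L'L.
Qed.

Lemma syzygy1 X K : is_syzygy X K -> syzygy 1 X K.
Proof. by apply: SyzygyS; apply: Syzygy0. Qed.

Lemma syzygy_split m n X L : syzygy (n + m) X L ->
  exists2 K, syzygy m X K & syzygy n K L.
Proof.
elim: n L => [|n IHn] L; first by exists L => //; apply: Syzygy0.
move=> /syzygy_inv[L' /IHn[K XK KL'] L'L]; exists K => //.
exact: SyzygyS KL' L'L.
Qed.

Lemma syzygySl n X L : syzygy n.+1 X L ->
  exists2 K, is_syzygy X K & syzygy n K L.
Proof.
rewrite -addn1 => /syzygy_split[K /syzygy_inv[X' /syzygy_inv <- XK] KL].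
by exists K.
Qed.

Lemma syzygy_cons n X K L : is_syzygy X K -> syzygy n K L -> syzygy n.+1 X L.
Proof. by move=> /syzygy1 XK KL; rewrite -addn1; apply: syzygy_add XK KL. Qed.

Definition ses (A B C : rmodType R) : Prop :=
  exists (i : {linear A -> B}) (p : {linear B -> C}),
    [/\ injective i, exact_at i p & surj p].

Lemma is_syzygyP X K : is_syzygy X K <-> exists P, projective P /\ ses K P X.
Proof.
split=> [[P [i [p [pP ? ? ?]]]]|[P [pP [i [p [? ? ?]]]]]].
  by exists P; split=> //; exists i, p.
by exists P, i, p.
Qed.

Lemma ker_val_linear (U V : rmodType R) (f : {linear U -> V}) :
  linear (@ker_val R U V f).
Proof. by []. Qed.

Lemma exact_ker (U V : rmodType R) (f : {linear U -> V}) :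
  exact_at (mklin (@ker_val_linear U V f)) f.
Proof.
move=> y; split=> [fy0|[x <-]]; last exact/eqP/(kerP x).
have yP : y \in ker_pred f by apply/eqP.
by exists (Ker yP).
Qed.

Lemma ses_ker (U V : rmodType R) (f : {linear U -> V}) : surj f -> ses (ker f) U V.
Proof.
move=> f_surj; exists (mklin (@ker_val_linear U V f)), f; split=> //.
  exact: val_inj.
exact: exact_ker.
Qed.

Lemma ses_biprod (A C : rmodType R) : ses A (A * C)%type C.
Proof.
exists (mklin (@inl_linear R A C)), (mklin (@snd_linear R A C)).
split=> [x y [] //||y]; last by exists (0, y).
by case=> a c; split=> /= [->|[x [_ <-]] //]; exists a.
Qed.

Lemma ses_split A B C : projective C -> ses A B C -> retr B (prodm A C).
Proof.
move=> pC [i [p [i_inj ip p_surj]]]; have [s sE] := proj_split pC p_surj.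
have [|t tE] := lift_through (h := idfun \- (s \o p)) i_inj.
  by move=> x; apply/ip; rewrite /= linearB sE subrr.
exists (mklin (pair_linear t p)), (mklin (copair_linear i s)) => x /=.
by rewrite tE /= subrK.
Qed.

(** Projective dimension at most n, phrased through successive syzygies. By [proj_syzygy] any choice
    of syzygies detects it; [resolution_pdle] links it to [pd]. *)
Fixpoint pdle n X : Prop :=
  if n is m.+1 then exists2 K, is_syzygy X K & pdle m K else projective X.

Lemma pdle_syzygy n X : pdle n X <-> exists2 K, syzygy n X K & projective K.
Proof.
elim: n X => [|n IHn] X /=.
  by split=> [pX|[K /syzygy_inv-> //]]; exists X => //; apply: Syzygy0.
split=> [[K XK /IHn[L KL pL]]|[L /syzygySl[K XK KL] pL]].
  by exists L => //; apply: syzygy_cons XK KL.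
by exists K => //; apply/IHn; exists L.
Qed.

Lemma proj_syzygy n X K : pdle n X -> syzygy n X K -> projective K.
Proof.
move=> /pdle_syzygy[L XL pL] XK; apply: sr_proj pL _.
exact: syzygy_sr XK XL (sr_refl X).
Qed.


Hypothesis noethR : noetherian R.

Lemma noeth_ker U (V : rmodType R) (f : {linear U -> V}) : fin_gen (ker f).
Proof. by apply: (@noethR U _ (mklin (@ker_val_linear U V f))); exact: val_inj. Qed.

Definition kerm U (V : rmodType R) (f : {linear U -> V}) : modr R := Modr (noeth_ker f).

Lemma is_syzygy_ex X : exists K, is_syzygy X K.
Proof.
have [n [p p_surj]] := fin_gen_cover X.
exists (kerm p); apply/is_syzygyP; exists (pow (ring_mod R) n).
by split; [apply: proj_pow; apply: proj_ring|apply: ses_ker].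
Qed.

Lemma syzygy_ex n X : exists K, syzygy n X K.
Proof.
elim: n => [|n [K XK]]; first by exists X; apply: Syzygy0.
by have [L KL] := is_syzygy_ex K; exists L; apply: SyzygyS XK KL.
Qed.

Lemma pdle_sr n X Y : stable_retract X Y -> pdle n Y -> pdle n X.
Proof.
move=> XY /pdle_syzygy[L YL pL]; have [K XK] := syzygy_ex n X.
by apply/pdle_syzygy; exists K => //; apply: sr_proj pL (syzygy_sr XK YL XY).
Qed.

Lemma pdle_is_syzygy n X K : pdle n.+1 X -> is_syzygy X K -> pdle n K.
Proof.
by move=> [L XL pL] XK; apply: pdle_sr pL; apply: is_syzygy_sr XK XL (sr_refl X).
Qed.

Lemma proj_pdle n X : projective X -> pdle n X.
Proof.
(* Stably X is zero, so the trivial syzygies of the zero module suffice. *)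
move=> pX; apply: (@pdle_sr _ _ (zero_mod R)); first exact: proj_sr.
elim: n {X pX} => [|n IHn] /=; first exact: proj_zero.
exists (zero_mod R) => //; apply/is_syzygyP; exists (zero_mod R).
split; first exact: proj_zero.
exists \0, \0; split=> [x y _|y|y]; rewrite ?(zero_modE y) ?(zero_modE x) //.
  by split=> // _; exists 0.
by exists 0.
Qed.

Lemma pdle_leq m n X : (m <= n)%N -> pdle m X -> pdle n X.
Proof.
elim: m n X => [|m IHm] [|n] X //; first by move=> _; apply: proj_pdle.
by move=> /IHm mn [K XK /mn]; exists K.
Qed.

(** The middle syzygy is the kernel of P + Q -> B given by u p on P and by a lift r of q through v
    on Q. *)
Lemma horseshoe A B C KA KC : ses A B C -> is_syzygy A KA -> is_syzygy C KC ->
  exists KB, is_syzygy B KB /\ ses KA KB KC.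
Proof.
move=> [u [v [u_inj uv v_surj]]] [P [i [p [pP i_inj ip p_surj]]]].
move=> [Q [j [q [pQ j_inj jq q_surj]]]].
have [r rE] := pQ _ _ v q v_surj.
have vu x : v (u x) = 0 by apply/uv; exists x.
have pi x : p (i x) = 0 by apply/ip; exists x.
pose f : {linear prodm P Q -> B} := mklin (copair_linear (u \o p) r).
have fE x : f x = u (p x.1) + r x.2 by [].
have f_surj : surj f.
  move=> b; have [y yE] := q_surj (v b).
  have [|a aE] := (uv (b - r y)).1; first by rewrite linearB rE yE subrr.
  by have [x xE] := p_surj a; exists (x, y); rewrite fE /= xE aE subrK.
pose val_ker : {linear kerm f -> prodm P Q} := mklin (@ker_val_linear _ _ f).
have valE x : f (val_ker x) = 0 by apply/exact_ker; exists x.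
have val_inj_ : injective val_ker by exact: val_inj.
exists (kerm f); split.
  by apply/is_syzygyP; exists (prodm P Q); split; [apply: proj_prod|apply: ses_ker].
have [|iK iKE] := lift_through (h := mklin (@inl_linear _ P Q) \o i) val_inj_.
  by move=> x; apply/exact_ker; rewrite fE /= pi !linear0 addr0.
have [|pK pKE] := lift_through (h := mklin (@snd_linear _ P Q) \o val_ker) j_inj.
  move=> x; apply/jq; rewrite /= -rE.
  have /eqP := valE x; rewrite fE addrC addr_eq0 => /eqP->.
  by rewrite linearN vu oppr0.
exists iK, pK; split=> [x y xy|x|k].
- by apply: i_inj; have := congr1 val_ker xy; rewrite !iKE => -[].
- split=> [pKx|[y <-]]; last by apply: j_inj; rewrite pKE -[LHS]/((val_ker (iK y)).2) iKE linear0.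
  have x2 : (val_ker x).2 = 0 by have := pKE x; rewrite pKx linear0 => /esym.
  have [|k kE] := (ip (val_ker x).1).1.
    by apply: u_inj; have := valE x; rewrite fE x2 !linear0 addr0.
  exists k; apply: val_inj_; rewrite iKE /= kE -x2 -surjective_pairing //.
- have [|a aE] := (uv (- r (j k))).1; first by rewrite linearN rE (jq (j k)).2 ?oppr0 //; exists k.
  have [x xE] := p_surj a.
  have [|y yE] := (exact_ker f (x, j k)).1; first by rewrite fE /= xE aE addNr.
  by exists y; apply: j_inj; rewrite pKE -[LHS]/((mklin (ker_val_linear (f:=f)) y).2) yE.
Qed.

(* Rotation of the triangle of a short exact sequence: once the middle term
   has become projective, the left term is a syzygy of the right one. *)
Lemma ses_shift d A B C K L : ses A B C -> pdle d B ->
  syzygy d A K -> syzygy d.+1 C L -> stable_retract K L /\ stable_retract L K.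
Proof.
elim: d A B C => [|d IHd] A B C ABC.
  move=> pB /syzygy_inv <- /syzygySl[L' CL' /syzygy_inv <-].
  have CA : is_syzygy C A by apply/is_syzygyP; exists B.
  by split; apply: is_syzygy_sr (sr_refl C).
move=> pB /syzygySl[KA AKA KAK] /syzygySl[KC CKC KCL].
have [KB [BKB]] := horseshoe ABC AKA CKC.
by move/IHd; apply=> //; apply: pdle_is_syzygy BKB.
Qed.

(** After d horseshoes the right-hand term is projective and the sequence splits, so the middle term
    is the left one up to a projective summand. *)
Lemma ses_syzygy_sr d A B C K L : ses A B C -> pdle d C ->
  syzygy d A K -> syzygy d B L -> stable_retract L K.
Proof.
elim: d A B C K L => [|d IHd] A B C K L ABC.
  move=> pC /syzygy_inv <- /syzygy_inv <-; apply/sr_prod; exists C.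
  by split=> //; apply: ses_split.
move=> [KC CKC pC] /syzygySl[KA AKA KAK] /syzygySl[KB BKB KBL].
have [KB' [BKB' S]] := horseshoe ABC AKA CKC.
have [L' KBL'] := syzygy_ex d KB'.
apply: sr_trans _ (IHd _ _ _ _ _ S pC KAK KBL').
by apply: syzygy_sr KBL KBL' _; apply: is_syzygy_sr BKB BKB' (sr_refl B).
Qed.

Lemma pdle_ext d A B C : ses A B C -> pdle d A -> pdle d C -> pdle d B.
Proof.
move=> ABC pA pC; have [K AK] := syzygy_ex d A; have [L BL] := syzygy_ex d B.
apply/pdle_syzygy; exists L => //; apply: sr_proj (proj_syzygy pA AK) _.
exact: ses_syzygy_sr ABC pC AK BL.
Qed.

End Syzygies.

(** * Exact functors and derived delooping levels *)

(** Dimensions enter only through upper bounds, so each infimum is traded for a witness below the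
    bound. *)
Lemma le_inf_enat (A : nat -> Prop) m :
  le_enat (inf_enat A) (Fin m) <-> exists2 n, (n <= m)%N & A n.
Proof.
rewrite /inf_enat; case: pselect => [exA|nA]; last first.
  by split=> // -[n _ An]; case: nA; exists n; apply/asboolP.
case: ex_minnP => n /asboolP An n_min; split; first by exists n.
by move=> [p pm Ap]; apply: leq_trans pm; apply: n_min; apply/asboolP.
Qed.

Lemma finite_inf_enat (A : nat -> Prop) : finite_enat (inf_enat A) <-> exists n, A n.
Proof.
split=> [|[n An]].
  case E: (inf_enat A) => [m|] // _.
  by have [|n _ An] := (le_inf_enat A m).1; [rewrite E /=|exists n].
have := (le_inf_enat A n).2; case: (inf_enat A) => // /(_ _).
by apply; exists n.
Qed.

Lemma finite_sup_enat (A : enat -> Prop) :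
  finite_enat (sup_enat A) <-> exists m, forall a, A a -> le_enat a (Fin m).
Proof. exact: finite_inf_enat. Qed.

(** * Projective dimension bounds the delooping levels *)

Section Dimensions.
Variable R : pzRingType.
Hypothesis noethR : noetherian R.
Implicit Types (X Y : modr R).

Lemma resolution_pdle n (C : nat -> modr R) X :
  (forall i, (i <= n)%N -> projective (C i)) -> exact_resolution n C X -> pdle n X.
Proof.
elim: n C X => [|n IHn] C X pC [d [a [a_surj da dd C0]]] /=.
  (* For n = 0 the term [C 1] vanishes, so the augmentation is an isomorphism. *)
  have a_inj : injective a.
    move=> x y xy; apply/eqP; rewrite -subr_eq0; apply/eqP.
    have [|z <-] := (da (x - y)).1; first by rewrite linearB xy subrr.
    by rewrite (C0 1%N isT z) linear0.
  have [|s sE] := lift_through (h := idfun : {linear X -> X}) a_inj; first by move=> x; apply: a_surj.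
  by apply: proj_retr (pC 0%N isT) _; exists s, a.
exists (kerm noethR a).
  by apply/is_syzygyP; exists (C 0%N); split; [apply: pC|apply: ses_ker].
pose val_ker : {linear kerm noethR a -> C 0%N} := mklin (@ker_val_linear _ _ _ a).
have val_inj_ : injective val_ker by exact: val_inj.
have [|a' aE] := lift_through (h := d 0%N) val_inj_.
  by move=> x; apply/exact_ker/da; exists x.
(* The shifted complex resolves the kernel of the augmentation. *)
apply: IHn (fun i => C i.+1) _ _ _; first by move=> i ilen; apply: pC.
exists (fun i => d i.+1), a'; split=> // [y|y|i ni x]; last exact: C0.
  have /da[x xE] : a (val_ker y) = 0 by apply/exact_ker; exists y.
  by exists x; apply: val_inj_; rewrite aE.
rewrite -dd; split=> [ay|dy]; first by rewrite -aE ay linear0.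
by apply: val_inj_; rewrite aE dy linear0.
Qed.

Lemma finite_pd X : finite_enat (pd X) -> exists n, pdle n X.
Proof.
by move=> /finite_inf_enat[n [C [pC CX]]]; exists n; apply: resolution_pdle pC CX.
Qed.

(** The n-th syzygy is projective, hence a stable retract of every module, in particular of a syzygy
    of Y = 0. *)
Lemma pdle_dell k n X : pdle n X -> le_enat (dell k X) (Fin n).
Proof.
move=> pX; apply/le_inf_enat; exists n => //.
have [K XK] := syzygy_ex noethR n X.
have [L YL] := syzygy_ex noethR (n + k) (zero_mod R).
by exists (zero_mod R), K, L; split=> //; apply: proj_sr; apply: proj_syzygy pX XK.
Qed.

Lemma pdle_ddell k n X : pdle n X -> le_enat (ddell k X) (Fin n).
Proof.
move=> pX; apply/le_inf_enat; exists n => //.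
(* With t = 0 the module X resolves itself, leaving only the bound on k-dell X. *)
exists 0%N, (fun i => if i is 0%N then X else zero_mod R); split=> //; last first.
  by case=> // _; rewrite subn0; apply: pdle_dell.
have zero_exact (U V W : modr R) (f : {linear U -> V}) (g : {linear V -> W}) :
    (forall y : V, y = 0) -> exact_at f g.
  by move=> V0 y; rewrite (V0 y) linear0; split=> // _; exists 0; rewrite linear0.
exists (fun=> \0), idfun; split=> [y|y|i|[|i] // _ x]; first by exists y.
- split=> [/= ->|[x <-]] //; by exists 0.
- by apply: zero_exact => y; apply: zero_modE.
- exact: zero_modE.
Qed.

Lemma ddell_iso k m X Y (f : {linear X -> Y}) : injective f -> surj f ->
  le_enat (ddell k X) (Fin m) -> le_enat (ddell k Y) (Fin m).
Proof.
move=> f_inj f_surj /le_inf_enat[n nm [t [C [tn [d [a [a_surj da dd C0]]] CE]]]].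
apply/le_inf_enat; exists n => //; exists t, C; split=> //.
exists d, (f \o a); split=> // y.
  by have [x <-] := f_surj y; have [z <-] := a_surj x; exists z.
by rewrite -da; split=> /= [fa|->]; [apply: f_inj; rewrite fa|]; rewrite linear0.
Qed.

End Dimensions.

(** The laws take pointwise commuting triangles as hypotheses, so that maps are compared by their
    values and not as bundled structures. *)
Record exact_functor (R S : pzRingType) := ExactFunctor {
  fobj :> modr R -> modr S;
  fmap : forall U V : modr R, {linear U -> V} -> {linear fobj U -> fobj V};
  fmap_id : forall (U : modr R) (f : {linear U -> U}),
    (forall x, f x = x) -> forall y, fmap f y = y;
  fmap_comp : forall (U V W : modr R) (f : {linear U -> V}) (g : {linear V -> W})
    (h : {linear U -> W}),
    (forall x, h x = g (f x)) -> forall y, fmap h y = fmap g (fmap f y);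
  fmapD : forall (U V : modr R) (f g h : {linear U -> V}),
    (forall x, h x = f x + g x) -> forall y, fmap h y = fmap f y + fmap g y;
  fmap_exact : forall (U V W : modr R) (f : {linear U -> V}) (g : {linear V -> W}),
    exact_at f g -> exact_at (fmap f) (fmap g);
  fmap_inj : forall (U V : modr R) (f : {linear U -> V}),
    injective f -> injective (fmap f);
  fmap_surj : forall (U V : modr R) (f : {linear U -> V}),
    surj f -> surj (fmap f)
}.

Arguments fmap {R S} _ {U V} f.
Arguments fmap_id {R S} _ {U f}.
Arguments fmap_comp {R S} _ {U V W f g h}.
Arguments fmapD {R S} _ {U V f g h}.
Arguments fmap_exact {R S} _ {U V W f g}.
Arguments fmap_inj {R S} _ {U V f}.
Arguments fmap_surj {R S} _ {U V f}.

(** * Exact functors sending the ring to a module of bounded projective dimension *)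

Section Functors.
Variables (R S : pzRingType) (F : exact_functor R S).
Implicit Types (X Y A B C K L P : modr R).

Lemma fmap_zero X Y (f : {linear X -> Y}) y : (forall x, f x = 0) -> fmap F f y = 0.
Proof.
move=> f0; apply: (@addrI _ (fmap F f y)).
by rewrite -(fmapD F (h := f)) ?addr0 // => x; rewrite f0 addr0.
Qed.

Lemma fobj_zero X : (forall x : X, x = 0) -> forall y : F X, y = 0.
Proof.
move=> X0 y; rewrite -(fmap_id F (f := idfun : {linear X -> X}) _ y) //.
exact: fmap_zero.
Qed.

Lemma fmap_ses A B C : ses A B C -> ses (F A) (F B) (F C).
Proof.
move=> [i [p [i_inj ip p_surj]]]; exists (fmap F i), (fmap F p).
by split; [apply: fmap_inj i_inj|apply: fmap_exact ip|apply: fmap_surj p_surj].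
Qed.

Lemma fmap_retr X Y : retr X Y -> retr (F X) (F Y).
Proof.
move=> [f [g gK]]; exists (fmap F f), (fmap F g) => x.
by rewrite -(fmap_comp F (h := idfun)) ?(fmap_id F).
Qed.

Lemma fobj_pow d X n : noetherian S -> pdle d (F X) -> pdle d (F (pow X n)).
Proof.
move=> noethS pX; elim: n => [|n IHn] /=.
  apply: proj_pdle => //; apply: proj_retr (@proj_zero S) _.
  exists \0, \0 => x; rewrite [RHS](fobj_zero (@zero_modE R)) //.
by apply: (pdle_ext noethS _ pX IHn); apply: fmap_ses; apply: ses_biprod.
Qed.

(** A finitely generated projective is a retract of some R^n, so the bound at R controls all of
    them. *)
Lemma fobj_proj_pdle d P : noetherian S -> pdle d (F (ring_mod R)) ->
  projective P -> pdle d (F P).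
Proof.
move=> noethS pF /proj_free[n /fmap_retr/sr_retr Pn].
by apply: pdle_sr Pn _ => //; apply: fobj_pow.
Qed.

Hypotheses (noethR : noetherian R) (noethS : noetherian S).
Variable d : nat.
Hypothesis F_pdle : pdle d (F (ring_mod R)).

(** F need not preserve projectives, but Omega^d (F P) is projective. If K is a retract of L + P,
    the summand F P therefore disappears stably after d syzygies. *)
Lemma fobj_sr K L (K' L' : modr S) : stable_retract K L ->
  syzygy d (F K) K' -> syzygy d (F L) L' -> stable_retract K' L'.
Proof.
move=> /sr_prod[P [pP /fmap_retr/sr_retr KLP]] FK FL.
have [M FM] := syzygy_ex noethS d (F (prodm L P)).
apply: sr_trans (syzygy_sr FK FM KLP) _.
have LP : ses L (prodm L P) P by apply: ses_biprod.
exact (ses_syzygy_sr noethS (fmap_ses LP) (fobj_proj_pdle noethS F_pdle pP) FL FM).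
Qed.

(* Omega^d (F (Omega^n X)) and Omega^(d + n) (F X) are stably equivalent. *)
Lemma fobj_syzygy n X K (K1 K2 : modr S) : syzygy n X K ->
  syzygy d (F K) K1 -> syzygy (d + n) (F X) K2 ->
  stable_retract K1 K2 /\ stable_retract K2 K1.
Proof.
elim: n K K1 K2 => [|n IHn] L K1 K2 /syzygy_inv.
  move=> <-; rewrite addn0 => FX1 FX2.
  by split; [apply: syzygy_sr FX1 FX2 _|apply: syzygy_sr FX2 FX1 _]; apply: sr_refl.
move=> [K XK /is_syzygyP[P [pP LPK]]] FL; rewrite addnS => /syzygy_inv[N XN NK2].
(* Apply F to 0 -> L -> P -> K -> 0. As F P has dimension at most d, Omega^d (F L) is stably
   Omega^(d+1) (F K), that is Omega of Omega^d (F K), to which induction applies. *)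
have [M FM] := syzygy_ex noethS d.+1 (F K).
have [K1M MK1] := ses_shift noethS (fmap_ses LPK) (fobj_proj_pdle noethS F_pdle pP) FL FM.
have /syzygy_inv[M0 FM0 M0M] := FM.
have [MN NM] := IHn _ _ _ XK FM0 XN.
split; first by apply: sr_trans K1M _; apply: is_syzygy_sr M0M NK2 MN.
by apply: sr_trans _ MK1; apply: is_syzygy_sr NK2 M0M NM.
Qed.

Lemma fobj_pdle n X : pdle n X -> pdle (d + n) (F X).
Proof.
move=> /pdle_syzygy[K XK pK]; have [K2 FX] := syzygy_ex noethS (d + n) (F X).
have [K1 FK] := syzygy_ex noethS d (F K).
apply/pdle_syzygy; exists K2 => //; apply: sr_proj (fobj_syzygy XK FK FX).2.
exact: proj_syzygy (fobj_proj_pdle noethS F_pdle pK) FK.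
Qed.

(** Omega^(d+n) (F X) is stably Omega^d (F (Omega^n X)), a stable retract of Omega^d (F (Omega^(n+k)
    Y)), which is stably Omega^(d+n+k) (F Y). *)
Lemma fobj_dell k m X : le_enat (dell k X) (Fin m) -> le_enat (dell k (F X)) (Fin (d + m)).
Proof.
move=> /le_inf_enat[n nm [Y [K [L [XK YL KL]]]]]; apply/le_inf_enat.
exists (d + n)%N; first by rewrite leq_add2l.
have [K1 FK] := syzygy_ex noethS d (F K); have [L1 FL] := syzygy_ex noethS d (F L).
have [K2 FX] := syzygy_ex noethS (d + n) (F X).
have [L2 FY] := syzygy_ex noethS (d + (n + k)) (F Y).
exists (F Y), K2, L2; split=> //; first by rewrite -addnA.
apply: sr_trans (fobj_syzygy XK FK FX).2 _.
apply: sr_trans _ (fobj_syzygy YL FL FY).1.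
exact: fobj_sr KL FK FL.
Qed.

Lemma fobj_ddell k m X : le_enat (ddell k X) (Fin m) -> le_enat (ddell k (F X)) (Fin (d + m)).
Proof.
move=> /le_inf_enat[n nm [t [C [tn [dC [a [a_surj da dd C0]]] CE]]]]; apply/le_inf_enat.
exists (d + n)%N; first by rewrite leq_add2l.
exists t, (fun i => F (C i)); split; first by rewrite (leq_trans tn) ?leq_addl.
  exists (fun i => fmap F (dC i)), (fmap F a); split.
  - exact: fmap_surj.
  - exact: fmap_exact.
  - by move=> i; apply: fmap_exact.
  - by move=> i /C0 Ci; apply: fobj_zero.
(* The budget at place i grows from n - i to d + (n - i), exactly what [fobj_dell] costs. *)
move=> i it; rewrite -addnBA ?(leq_trans it tn) //.
by apply: fobj_dell; apply: CE.
Qed.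

End Functors.

(** * Corner rings: inflation and restriction *)

(** Equivalent to multiplicativity of x |-> e x e, which is then a surjective ring homomorphism R ->
    e R e. *)
Definition convex (R : pzRingType) (e : idem R) : Prop :=
  forall x y : R, (e : R) * x * (e : R) * y * (e : R) = (e : R) * x * y * (e : R).

Section CornerProj.
Variables (R : pzRingType) (e : idem R).

Lemma cproj_subproof (x : R) : (e : R) * x * (e : R) \in peirce_pred e e.
Proof. by rewrite in_peirce !mulrA idemP -!mulrA idemP. Qed.

Definition cproj (x : R) : corner e := Peirce (cproj_subproof x).

Lemma cprojD x y : cproj (x + y) = cproj x + cproj y.
Proof. by apply: val_inj; rewrite /= mulrDr mulrDl. Qed.

Lemma cproj1 : cproj 1 = 1.
Proof. by apply: val_inj; rewrite /= mulr1 idemP. Qed.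

Lemma cproj_val (x : corner e) : cproj (peirce_val x) = x.
Proof. by apply: val_inj; rewrite /= peirceE. Qed.

Hypothesis convex_e : convex e.

Lemma cprojM x y : cproj (x * y) = cproj x * cproj y.
Proof.
by apply: val_inj; rewrite /= !mulrA -[_ * (e : R) * (e : R)]mulrA idemP convex_e.
Qed.

End CornerProj.

(** An alias for the carrier of T. It takes the convexity proof as an argument because the laws of
    the R-action rest on it. *)
Definition infl (R : pzRingType) (e : idem R) (_ : convex e)
  (T : rmodType (corner e)) : Type := T.

Section Inflation.
Variables (R : pzRingType) (e : idem R) (convex_e : convex e).
Local Notation "x ** r" := (((r : R) : R^c) *: x) (at level 40, left associativity).

Section InflModule.
Variable T : rmodType (corner e).

Definition infl_act (r : R^c) (x : T) : T := (cproj e r : (corner e)^c) *: x.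

Lemma infl_actA r s x : infl_act r (infl_act s x) = infl_act (r * s) x.
Proof. by rewrite /infl_act scalerA; congr (_ *: x); rewrite [RHS](cprojM convex_e). Qed.
Lemma infl_act1 : left_id 1 infl_act.
Proof. by move=> x; rewrite /infl_act (cproj1 e) scale1r. Qed.
Lemma infl_actDr : right_distributive infl_act +%R.
Proof. by move=> r x y; rewrite /infl_act scalerDr. Qed.
Lemma infl_actDl x : {morph infl_act^~ x : r s / r + s}.
Proof. by move=> r s; rewrite /infl_act cprojD scalerDl. Qed.

HB.instance Definition _ := GRing.Zmodule.copy (infl convex_e T) T.
HB.instance Definition _ := GRing.Zmodule_isLmodule.Build R^c (infl convex_e T)
  infl_actA infl_act1 infl_actDr infl_actDl.

Lemma inflE (x : infl convex_e T) (r : R) :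
  x ** r = (cproj e r : (corner e)^c) *: (x : T).
Proof. by []. Qed.

Lemma fin_gen_infl : fin_gen (infl convex_e T : rmodType R) <-> fin_gen T.
Proof.
split=> -[n [g gP]]; exists n, g => x; have [c ->] := gP x.
  by exists (fun i => cproj e (c i)).
exists (fun i => peirce_val (c i)); apply: eq_bigr => i _.
by rewrite inflE cproj_val.
Qed.
End InflModule.

Lemma inflmap_linear (T U : rmodType (corner e)) (f : {linear T -> U}) :
  linear (f : infl convex_e T -> infl convex_e U).
Proof. by move=> r x y; rewrite [LHS](linearP f). Qed.

Definition inflm (T : modr (corner e)) : modr R :=
  Modr ((fin_gen_infl T).2 (modr_fin_gen T)).

Definition inflmap (T U : modr (corner e)) (f : {linear T -> U}) :
  {linear inflm T -> inflm U} := mklin (inflmap_linear f).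

Definition inflation : exact_functor (corner e) R.
Proof.
refine (@ExactFunctor _ _ inflm inflmap _ _ _ _ _ _) => //.
Defined.

(** Inflation keeps the underlying maps, and since R -> e R e is onto, it preserves and reflects
    finite generation. *)
Lemma noetherian_corner : noetherian R -> noetherian (corner e).
Proof.
move=> noethR X M i i_inj; apply/fin_gen_infl.
exact: (noethR (inflm X) _ (mklin (inflmap_linear i))).
Qed.

End Inflation.

(** * The restriction functor M |-> M e *)

Section FixedPart.
Variables (R : pzRingType) (e : idem R).
Local Notation "x ** r" := (((r : R) : R^c) *: x) (at level 40, left associativity).

Lemma actM (M : rmodType R) (x : M) (r s : R) : x ** r ** s = x ** (r * s).
Proof. by rewrite scalerA. Qed.

Section FixedModule.
Variable M : rmodType R.

Definition fix_pred : {pred M} := fun x => x ** e == x.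

Lemma in_fix x : (x \in fix_pred) = (x ** e == x).
Proof. by []. Qed.

Lemma fix_pred_zmod : zmod_closed fix_pred.
Proof.
split; first by rewrite in_fix scaler0.
by move=> x y; rewrite !in_fix scalerBr => /eqP-> /eqP->.
Qed.

HB.instance Definition _ := GRing.isZmodClosed.Build M fix_pred fix_pred_zmod.

Record fixm := Fixm { fix_val :> M; fixP : fix_val \in fix_pred }.

HB.instance Definition _ := [isSub for fix_val].
HB.instance Definition _ := [Choice of fixm by <:].
HB.instance Definition _ := [SubChoice_isSubZmodule of fixm by <:].

Lemma fixE (x : fixm) : fix_val x ** e = fix_val x.
Proof. exact/eqP/(fixP x). Qed.

Lemma fix_act_subproof (s : (corner e)^c) (x : fixm) :
  fix_val x ** (peirce_val s) \in fix_pred.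
Proof. by rewrite in_fix actM peirce_r. Qed.

Definition fix_act s x : fixm := Fixm (fix_act_subproof s x).

Lemma fix_actA r s x : fix_act r (fix_act s x) = fix_act (r * s) x.
Proof. by apply: val_inj; rewrite /= actM. Qed.
Lemma fix_act1 : left_id 1 fix_act.
Proof. by move=> x; apply: val_inj; rewrite /= fixE. Qed.
Lemma fix_actDr : right_distributive fix_act +%R.
Proof. by move=> r x y; apply: val_inj; rewrite /= scalerDr. Qed.
Lemma fix_actDl x : {morph fix_act^~ x : r s / r + s}.
Proof. by move=> r s; apply: val_inj; rewrite /= scalerDl. Qed.

HB.instance Definition _ := GRing.Zmodule_isLmodule.Build (corner e)^c fixm
  fix_actA fix_act1 fix_actDr fix_actDl.

Lemma fix_subproof (x : M) : x ** e \in fix_pred.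
Proof. by rewrite in_fix actM idemP. Qed.

Definition fixproj (x : M) : fixm := Fixm (fix_subproof x).
End FixedModule.

Lemma fixmap_subproof (M N : rmodType R) (f : {linear M -> N}) (x : fixm M) :
  f (fix_val x) \in @fix_pred N.
Proof. by rewrite in_fix -linearZ /= fixE. Qed.

Lemma fixmap_linear (M N : rmodType R) (f : {linear M -> N}) :
  linear (fun x : fixm M => Fixm (fixmap_subproof f x)).
Proof. by move=> s x y; apply: val_inj; rewrite /= linearP. Qed.

Definition fixmap (M N : rmodType R) (f : {linear M -> N}) := mklin (fixmap_linear f).

Lemma fixmap_surj (M N : rmodType R) (f : {linear M -> N}) : surj f -> surj (fixmap f).
Proof.
move=> f_surj y; have [x xE] := f_surj (fix_val y); exists (fixproj x).
by apply: val_inj; rewrite /= linearZ xE /= fixE.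
Qed.

Hypothesis fix_ring : fin_gen (fixm R^c^o).

(** A cover of M by R^n restricts to a cover of M e by (R e)^n. *)
Lemma fin_gen_fix (M : modr R) : fin_gen (fixm M).
Proof.
have [n [p /fixmap_surj p_surj]] := fin_gen_cover M; apply: fin_gen_surj p_surj _.
elim: n {p} => [|n IHn] /=.
  exists 0%N, (fun=> 0) => x; exists (fun=> 0); rewrite big_ord0.
  by apply: val_inj; apply: zero_modE.
have fP (x : (fixm R^c^o * fixm (pow (ring_mod R) n))%type) :
    (fix_val x.1, fix_val x.2) \in @fix_pred (R^c^o * pow (ring_mod R) n)%type.
  by rewrite in_fix; apply/eqP; congr (_, _); exact: fixE.
have fL : linear (fun x => Fixm (fP x)) by move=> s x y; apply: val_inj.
apply: (@fin_gen_surj _ _ _ (mklin fL) _ (fin_gen_prod fix_ring IHn)) => -[[x y] xyE].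
have xE : x \in @fix_pred R^c^o by move: xyE; rewrite !in_fix => /eqP[{2}<- _].
have yE : y \in @fix_pred (pow (ring_mod R) n) by move: xyE; rewrite !in_fix => /eqP[_ {2}<-].
by exists (Fixm xE, Fixm yE); apply: val_inj.
Qed.

Definition fixmod (M : modr R) : modr (corner e) := Modr (fin_gen_fix M).

Definition fixed_part : exact_functor R (corner e).
Proof.
refine (@ExactFunctor _ _ fixmod (fun U V => @fixmap U V) _ _ _ _ _ _).
- by move=> U f fE x; apply: val_inj; apply: fE.
- by move=> U V W f g h hE x; apply: val_inj; apply: hE.
- by move=> U V f g h hE x; apply: val_inj; apply: hE.
- move=> U V W f g fg y; split=> [/(congr1 val)/= /fg[x xE]|[x <-]].
    (* A preimage of a fixed element becomes fixed after multiplication by e. *)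
    by exists (fixproj x); apply: val_inj; rewrite /= linearZ xE /= fixE.
  by apply: val_inj => /=; apply/fg; exists x.
- by move=> U V f f_inj x y xy; apply: val_inj; apply: f_inj; apply: (congr1 val xy).
- by move=> U V f; apply: fixmap_surj.
Defined.

End FixedPart.

(** * Composites of inflation and restriction *)

Section Adjunction.
Variables (R : pzRingType) (e : idem R) (convex_e : convex e).
Local Notation "x ** r" := (((r : R) : R^c) *: x) (at level 40, left associativity).

Lemma fix_infl (T : rmodType (corner e)) :
  exists f : {linear fixm e (infl convex_e T) -> T}, injective f /\ surj f.
Proof.
have fL : linear (fun x : fixm e (infl convex_e T) => fix_val x : T).
  by move=> s x y /=; rewrite inflE cproj_val.
exists (mklin fL); split=> [x y xy|x]; first exact: val_inj.
have xE : (x : infl convex_e T) \in @fix_pred R e (infl convex_e T).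
  rewrite in_fix inflE (_ : cproj e e = 1) ?scale1r //.
  by apply: val_inj; rewrite /= !idemP.
by exists (Fixm xE).
Qed.

Lemma infl_fix (M : rmodType R) : (forall x : M, x ** e = x) ->
  exists f : {linear infl convex_e (fixm e M) -> M}, injective f /\ surj f.
Proof.
move=> Me.
have fL : linear (fun x : infl convex_e (fixm e M) => fix_val x).
  move=> r x y /=; congr (_ + _).
  by rewrite -!actM fixE Me.
exists (mklin fL); split=> [x y xy|x]; first exact: val_inj.
have xE : x \in @fix_pred R e M by rewrite in_fix Me.
by exists (Fixm xE).
Qed.

End Adjunction.

(** * Directed idempotents *)

Section Directed.
Variable R : pzRingType.
Hypothesis noethR : noetherian R.
Local Notation "x ** r" := (((r : R) : R^c) *: x) (at level 40, left associativity).

Definition lmul (a : R) (x : R^c^o) : R^c^o := a * (x : R).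

Lemma lmul_linear a : linear (lmul a).
Proof.
by move=> c x y; exact: etrans (mulrDr a _ _) (congr1 (+%R^~ _) (mulrA a _ _)).
Qed.

(* For idempotent a this is the right ideal a R. *)
Definition pim (a : R) : modr R := 
  @kerm R noethR (ring_mod R) R^c^o (idfun \- mklin (lmul_linear a)).

Definition pim_val (a : R) : {linear pim a -> R^c^o} := mklin (@ker_val_linear _ _ _ _).

Arguments pim_val {a}.

Lemma pim_val_inj a : injective (@pim_val a).
Proof. exact: val_inj. Qed.

Lemma pimE a (x : pim a) : a * (pim_val x : R) = pim_val x.
Proof. by apply/esym/eqP; rewrite -subr_eq0; exact: (kerP x). Qed.

Lemma pimP a (x : R) : a * x = x -> exists y : pim a, pim_val y = x.
Proof.
move=> ax; apply/exact_ker; rewrite -[LHS]/(x - a * x) ax; exact: subrr.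
Qed.

Lemma proj_pim a : a * a = a -> projective (pim a).
Proof.
move=> aa; apply: proj_retr (@proj_ring R) _.
have [|g gE] := lift_through (h := mklin (lmul_linear a)) (@pim_val_inj a).
  by move=> x; apply: pimP; rewrite /= /lmul mulrA aa.
exists (@pim_val a), g => x; apply: pim_val_inj; rewrite gE; exact: pimE.
Qed.

Lemma pow_act (V : modr R) (r s : R) : (forall x : V, x ** r = x ** s) ->
  forall n (x : pow V n), x ** r = x ** s.
Proof.
move=> V_rs; elim=> [|n IHn] /= x; first by rewrite (zero_modE x) !scaler0.
by congr (_, _); [apply: V_rs|apply: IHn].
Qed.

Section Span.
Variables (M : rmodType R) (D : R -> Prop).
Hypotheses (D0 : D 0) (DD : forall x y, D x -> D y -> D (x + y)).
Hypothesis DM : forall x y, D x -> D y -> D (x * y).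
Implicit Types (s : seq M) (x y : M).

Lemma span0 s : spanned D s 0.
Proof.
by elim: s => //= y s IHs; exists 0; rewrite scale0r subr0.
Qed.

Lemma spanD s x y : spanned D s x -> spanned D s y -> spanned D s (x + y).
Proof.
elim: s x y => [|z s IHs] x y /=; first by move=> -> ->; rewrite addr0.
move=> [c [Dc sx]] [d [Dd sy]]; exists (c + d); split; first exact: DD.
by rewrite scalerDl opprD addrACA; apply: IHs.
Qed.

Lemma spanZ s x r : D r -> spanned D s x -> spanned D s (x ** r).
Proof.
move=> Dr; elim: s x => [|z s IHs] x /=; first by move->; rewrite scaler0.
move=> [c [Dc sx]]; exists ((c : R) * r); split; first exact: DM.
by rewrite -(actM (R := R)) -scalerBr; apply: IHs.
Qed.

Lemma spanW (E : R -> Prop) s x : (forall r, D r -> E r) -> spanned D s x -> spanned E s x.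
Proof.
move=> DE; elim: s x => [|z s IHs] x //= [c [Dc sx]].
by exists c; split; [apply: DE|apply: IHs].
Qed.

(** For a division ring D this is linear independence in triangular form. *)
Fixpoint free_seq s : Prop := if s is y :: s' then ~ spanned D s' y /\ free_seq s' else True.
End Span.

(** An entry in the D-span of those already kept is dropped, which does not shrink the R-span. *)
Lemma free_basis (M : rmodType R) (D : R -> Prop) (P : M -> Prop) (s : seq M) :
  {in s, forall y, P y} ->
  exists s', [/\ free_seq D s', {in s', forall y, P y} &
    forall x, spanned (fun=> True) s x -> spanned (fun=> True) s' x].
Proof.
elim: s => [|y s IHs] sP; first by exists [::].
have [|s' [s'_free s'P s's]] := IHs; first by move=> z zs; apply: sP; rewrite inE zs orbT.
have [s'y|s'y] := pselect (spanned D s' y).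
  exists s'; split=> // x /= [r [_ /s's sx]]; rewrite -[x](subrK (r *: y)).
  by apply: spanD => //; apply: spanZ => //; apply: spanW s'y.
exists (y :: s'); split=> //= [z|x [r [_ /s's sx]]]; last by exists r.
by rewrite inE => /predU1P[->|/s'P //]; apply: sP; rewrite mem_head.
Qed.

Section Cover.
Variables (M : rmodType R) (a : R).
Hypothesis aa : a * a = a.
Local Notation h := (powmap (@pim_val a)).

(** Since y = y a, a coefficient d may be replaced by a d, which lies in a R. *)
Lemma cover_pim (s : seq M) x : {in s, forall y, y ** a = y} ->
  spanned (fun=> True) s x -> exists b, h s b = x.
Proof.
elim: s x => [|y s IHs] x sa /=; first by move->; exists 0.
move=> [d [_ /IHs[|b bE]]]; first by move=> z zs; apply: sa; rewrite inE zs orbT.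
have [|b0 b0E] := @pimP a (a * (d : R)); first by rewrite mulrA aa.
exists (b0, b); rewrite -[LHS]/(y ** pim_val b0 + h s b) bE b0E.
by rewrite -(actM (R := R)) sa ?mem_head // addrC subrK.
Qed.

Let D r := a * r * a = r.

Lemma span_cover (s : seq M) (b : pow (pim a) (size s)) :
  {in s, forall y, y ** a = y} -> spanned D s (h s b ** a).
Proof.
elim: s b => [|y s IHs] b sa /=; first by rewrite scaler0.
exists ((pim_val b.1 : R) * a); split.
  by rewrite /D mulrA pimE -mulrA aa.
rewrite -[X in X ** a]/(y ** pim_val b.1 + h s b.2) scalerDr (actM (R := R)).
rewrite addrAC subrr add0r; apply: IHs => z zs.
by apply: sa; rewrite inE zs orbT.
Qed.

Hypothesis a_div : forall r, a * r * a != 0 -> exists t, a * r * a * (a * t * a) = a.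

Lemma cover_free (s : seq M) (b : pow (pim a) (size s)) : free_seq D s ->
  {in s, forall y, y ** a = y} -> h s b ** a = 0 -> b ** a = 0.
Proof.
elim: s b => [|y s IHs] b /=; first by move=> *; apply: zero_modE.
move=> [ny s_free] sa; rewrite -[X in X ** a]/(y ** pim_val b.1 + h s b.2).
have sa' : {in s, forall y, y ** a = y} by move=> z zs; apply: sa; rewrite inE zs orbT.
rewrite scalerDr (actM (R := R)) => hb0.
have c0 : (pim_val b.1 : R) * a = 0.
  (* A nonzero leading coefficient would be invertible in a R a and put y in the D-span of the
     remaining entries. *)
  apply/eqP/negP => /negP; rewrite -[pim_val b.1]pimE => /a_div[t tE].
  case: ny; rewrite -[y]sa ?mem_head // -tE -(actM (R := R)).
  move/eqP: hb0; rewrite addr_eq0 pimE => /eqP->; rewrite scalerN -scaleNr.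
  apply: spanZ (span_cover _ sa') => [x1 x2|]; rewrite /D.
    by move=> <- <-; rewrite !mulrA aa -[_ * a * a]mulrA aa.
  rewrite mulrN mulNr; congr (- _); by rewrite !mulrA aa -[_ * a * a]mulrA aa.
congr (_, _).
  by apply: pim_val_inj; rewrite linearZ linear0; exact: c0.
by apply: IHs => //; move: hb0; rewrite c0 scale0r add0r.
Qed.
End Cover.

(* [directed n d] decomposes the idempotent d into n orthogonal primitive ones,
   ordered so that no later one maps back to an earlier one, with division
   rings as endomorphism rings. *)
Inductive directed : nat -> R -> Prop :=
| Directed0 : directed 0 0
| DirectedS n a d : a * a = a -> d * d = d -> a * d = 0 ->
    (forall r, d * r * a = 0) ->
    (forall r, a * r * a != 0 -> exists t, a * r * a * (a * t * a) = a) ->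
    directed n d -> directed n.+1 (a + d).

(* Cover M by (a R)^s x (d R)^t, where s comes from a basis of M a over the
   division ring a R a: the kernel is then annihilated by a, hence lives on d. *)
Lemma directed_pdle n d : directed n d -> (forall r, d * r * d = d * r) ->
  forall M : modr R, (forall x : M, x ** d = x) -> pdle n M.
Proof.
elim=> {n d} [_ M M0|n a d aa dd ad da a_div _ IHd closed M Mad].
  apply: proj_retr (@proj_zero R) _; exists \0, \0 => x.
  by rewrite -[RHS]M0 scale0r.
have da0 : d * a = 0 by rewrite -[d]mulr1 da.
have closed_d r : d * r * d = d * r.
  have := closed (d * r); rewrite mulrDr !mulrDl !mulrA ad !mul0r !add0r dd.
  by rewrite da add0r.
have a_closed r : a * r * (a + d) = a * r.
  by have := closed (a * r); rewrite !mulrA mulrDl aa da0 addr0.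
have [z zP] := (fin_gen_spanned M).1 (modr_fin_gen M).
pose D r := a * r * a = r.
have D0 : D 0 by rewrite /D mulr0 mul0r.
have DD x y : D x -> D y -> D (x + y) by rewrite /D mulrDr mulrDl => -> ->.
have DM x y : D x -> D y -> D (x * y).
  by rewrite /D => <- <-; rewrite !mulrA aa -[_ * a * a]mulrA aa.
have [|sa [sa_free sa_a sa_span]] :=
    @free_basis M D (fun y => y ** a = y) [seq y ** a | y <- z].
  by move=> _ /mapP[y _ ->]; rewrite (actM (R := R)) aa.
pose sd := [seq y ** d | y <- z].
have sd_d : {in sd, forall y, y ** d = y}.
  by move=> _ /mapP[y _ ->]; rewrite (actM (R := R)) dd.
pose ha := powmap (@pim_val a) sa; pose hd := powmap (@pim_val d) sd.
pose P := prodm (pow (pim a) (size sa)) (pow (pim d) (size sd)).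
pose h : {linear P -> M} := mklin (copair_linear ha hd).
have hE x : h x = ha x.1 + hd x.2 by [].
have h_surj : surj h.
  (* As a + d acts as the identity on M, each term y r splits as (y a) r + (y d) r. *)
  move=> x; have [xa [xd [sxa sxd ->]]] : exists xa xd,
     [/\ spanned (fun=> True) [seq y ** a | y <- z] xa,
         spanned (fun=> True) sd xd & x = xa + xd].
    rewrite /sd; elim: z x {zP sa sa_free sa_a sa_span sd sd_d ha hd P h hE} (zP x)
      => [|y z IHz] x /=; first by move->; exists 0, 0; rewrite addr0.
    move=> [r [_ /IHz[xa [xd [sxa sxd xE]]]]].
    exists (xa + y ** a ** r), (xd + y ** d ** r); split.
    - by exists r; rewrite addrK.
    - by exists r; rewrite addrK.
    by rewrite addrACA -xE -scalerDr -scalerDl Mad subrK.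
  have [b bE] := cover_pim aa sa_a (sa_span _ sxa).
  have [c cE] := cover_pim dd sd_d sxd.
  by exists (b, c); rewrite hE /= -bE -cE.
exists (kerm noethR h).
  apply/is_syzygyP; exists P; split; last exact: ses_ker.
  by apply: proj_prod; apply: proj_pow; apply: proj_pim.
apply: IHd => // k; apply: val_inj; case: k => -[b c] /=.
rewrite unfold_in hE /= => /eqP hbc.
(* Since d R a = 0, a kills c, so h_a(b) a = 0 and freeness gives b a = 0. As a + d fixes a R and d
   fixes d R on the right, d then fixes both b and c. *)
have c_a : c ** a = 0.
  rewrite -[RHS](scale0r c); apply: pow_act => x; apply: pim_val_inj.
  by rewrite scale0r linear0 linearZ -[pim_val x]pimE; apply: da.
have b_a : b ** a = 0.
  apply: (cover_free aa a_div sa_free sa_a).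
  have := congr1 (fun x => x ** a) hbc; rewrite scalerDr scaler0.
  have -> : hd c ** a = hd (c ** a) by rewrite linearZ.
  by rewrite c_a linear0 addr0.
congr (_, _).
  rewrite -[LHS]add0r -b_a -scalerDl -[RHS]scale1r; apply: pow_act => x.
  by apply: pim_val_inj; rewrite !linearZ -[pim_val x]pimE [LHS]a_closed [RHS]mulr1.
rewrite -[RHS]scale1r; apply: pow_act => x.
by apply: pim_val_inj; rewrite !linearZ -[pim_val x]pimE [LHS]closed_d [RHS]mulr1.
Qed.

End Directed.
Arguments pim_val {R noethR a}.

(** The conditions survive the surjection R -> e R e: an element of the corner is its own lift, and
    a nonzero image comes from a nonzero element. *)
Lemma directed_cproj (R : pzRingType) (e : idem R) n d : convex e ->
  directed n d -> directed n (cproj e d).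
Proof.
move=> convex_e; elim=> {n d} [|n a d aa dd ad da a_div _ IHd].
  rewrite (_ : cproj e 0 = 0); first exact: Directed0.
  by apply: val_inj; rewrite /= mulr0 mul0r.
have c0 : cproj e 0 = 0 by apply: val_inj; rewrite /= mulr0 mul0r.
rewrite cprojD; apply: DirectedS => // [|||r|r]; rewrite -?cprojM ?aa ?dd ?ad //.
  by rewrite -[r]cproj_val -!cprojM // da.
rewrite -[r]cproj_val -!cprojM // => ne0.
have [|t tE] := a_div (peirce_val r).
  by apply: contraNneq ne0 => ->; rewrite c0.
by exists (cproj e t); rewrite -!cprojM // tE.
Qed.

(** * Rings cut into three pieces by idempotents *)

Lemma linear_bij_inv_surj (R : pzRingType) (U V : rmodType R) (f : {linear U -> V}) :
  injective f -> surj f ->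
  exists g : {linear V -> U}, surj g.
Proof.
move=> f_inj f_surj; have [//|g gE] := lift_through (h := idfun) f_inj.
by exists g => x; exists (f x); apply: f_inj; rewrite gE.
Qed.

Section Trisection.
Variables (R : pzRingType) (em e ep : idem R).
Local Notation "x ** r" := (((r : R) : R^c) *: x) (at level 40, left associativity).
Hypothesis noethR : noetherian R.
Hypothesis sum1 : (em : R) + (e : R) + (ep : R) = 1.
Hypothesis e_em : forall r, (e : R) * r * (em : R) = 0.
Hypothesis ep_e : forall r, (ep : R) * r * (e : R) = 0.
Hypothesis ep_em : forall r, (ep : R) * r * (em : R) = 0.
Variables (nm np : nat).
Hypothesis directed_m : directed nm (em : R).
Hypothesis directed_p : directed np (ep : R).
Hypothesis pd_finite : finite_enat (pd (peirce_mod em e : rmodType (corner e))).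

Let e_em0 : (e : R) * (em : R) = 0. Proof. by rewrite -[e : R]mulr1 e_em. Qed.

Let split_act (M : rmodType R) (x : M) : x = x ** em + x ** e + x ** ep.
Proof. by rewrite -!scalerDl sum1 scale1r. Qed.

Let rsplit (r : R) : r = r * (em : R) + r * (e : R) + r * (ep : R).
Proof. by rewrite -!mulrDr sum1 mulr1. Qed.

(** Inserting 1 = em + e + ep between x and y leaves only the middle term, because e R em = 0 and ep
    R e = 0. *)
Lemma convex_e : convex e.
Proof.
move=> x y; rewrite -[in RHS](mulr1 ((e : R) * x)) -sum1 !mulrDr !mulrDl.
have -> : (e : R) * x * (ep : R) * y * (e : R) = 0.
  by rewrite -!mulrA (mulrA (ep : R)) ep_e !mulr0.
by rewrite e_em !mul0r add0r addr0.
Qed.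

Lemma convex_em : convex em.
Proof.
move=> x y; rewrite -[in RHS](mulr1 ((em : R) * x)) -sum1 !mulrDr !mulrDl.
have -> : (em : R) * x * (ep : R) * y * (em : R) = 0.
  by rewrite -!mulrA (mulrA (ep : R)) ep_em !mulr0.
have -> : (em : R) * x * (e : R) * y * (em : R) = 0.
  by rewrite -!mulrA (mulrA (e : R)) e_em !mulr0.
by rewrite !addr0.
Qed.

Let noeth_e := noetherian_corner convex_e noethR.
Let noeth_em := noetherian_corner convex_em noethR.
Let G := inflation convex_e.
Let Gm := inflation convex_em.

Lemma pdle_ep (M : modr R) : (forall x : M, x ** ep = x) -> pdle np M.
Proof.
apply: directed_pdle => // r.
by rewrite -[RHS]mulr1 -sum1 !mulrDr ep_em ep_e !add0r.
Qed.

Lemma cproj_pim_linear (f : idem R) (cf : convex f) :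
  linear (fun x : pim noethR f => cproj f (pim_val x) : infl cf ((corner f)^c^o)).
Proof.
move=> r x y; rewrite linearP [LHS]cprojD; congr (_ + _).
by rewrite [LHS](cprojM cf).
Qed.

Lemma cproj_pim_surj (f : idem R) :
  surj (fun x : pim noethR f => cproj f (pim_val x)).
Proof.
move=> y; have [x xE] := pimP noethR (peirce_l y).
by exists x; rewrite xE cproj_val.
Qed.

(* The kernel of f R -> f R f, x |-> x f, is the part of f R killed by f. *)
Lemma pdle_infl_ring (f : idem R) (cf : convex f) n :
  (forall M : modr R, (forall x : M, x ** f = 0) ->
     (exists2 i : {linear M -> pim noethR f}, injective i &
        forall y, y ** f = 0 -> exists x, i x = y) -> pdle n M) ->
  pdle n.+1 (inflation cf (ring_mod (corner f))).
Proof.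
move=> fn; pose p : {linear pim noethR f -> inflation cf (ring_mod (corner f))} :=
  mklin (cproj_pim_linear cf).
exists (kerm noethR p).
  apply/is_syzygyP; exists (pim noethR f); split; first by apply: proj_pim; apply: idemP.
  by apply: ses_ker; exact: cproj_pim_surj.
apply: fn => [k|]; last first.
  exists (mklin (@ker_val_linear _ _ _ p)) => [|y yf]; first exact: val_inj.
  apply/exact_ker/val_inj => /=; rewrite pimE.
  by have := congr1 pim_val yf; rewrite linearZ linear0.
apply: val_inj => /=; apply: (@pim_val_inj R noethR f).
have k0 : (pim_val (ker_val k) : R) * (f : R) = 0.
  by have /eqP/(congr1 (@peirce_val _ f f)) := kerP k; rewrite /= pimE.
by rewrite linearZ linear0; exact: k0.
Qed.

(** The part of e R killed by e is also killed by em, since e R em = 0; hence it lives on ep. *)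
Lemma pdle_G_ring : pdle np.+1 (G (ring_mod (corner e))).
Proof.
apply: pdle_infl_ring => M Me [i i_inj _]; apply: pdle_ep => x.
rewrite [RHS]split_act Me addr0 (_ : x ** em = 0) ?add0r //.
apply: i_inj; apply: pim_val_inj; rewrite !linearZ !linear0 -[pim_val _]pimE.
exact: e_em.
Qed.

(** Finite projective dimension provides a resolution, whose term [C 0] is finitely generated and
    maps onto em R e. *)
Lemma fin_gen_peirce : fin_gen (peirce_mod em e : rmodType (corner e)).
Proof.
have /finite_inf_enat[n [C [_ [d [a [a_surj _ _ _]]]]]] := pd_finite.
exact: fin_gen_surj a_surj (modr_fin_gen (C 0%N)).
Qed.

Let E : modr (corner e) := Modr fin_gen_peirce.

Lemma pdle_E : exists n, pdle n E.
Proof. exact: (finite_pd noeth_e (X := E)). Qed.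

Lemma pdle_G n (X : modr (corner e)) : pdle n X -> pdle (np.+1 + n) (G X).
Proof. exact: fobj_pdle pdle_G_ring n X. Qed.

(** The part M of em R killed by em is additively em R e + em R ep. Right multiplication by e maps M
    onto the inflation of em R e, with a kernel living on ep; both ends have finite projective
    dimension. *)
Lemma pdle_Gm_ring : exists n, pdle n (Gm (ring_mod (corner em))).
Proof.
have [n En] := pdle_E; exists (np.+1 + n).+1.
apply: pdle_infl_ring => M Mem [i i_inj i_surj].
pose v x : R := pim_val (i x).
have v_inj : injective v by move=> x y /pim_val_inj/i_inj.
have vP r x y : v (r *: x + y) = v x * (r : R) + v y.
  by rewrite /v !linearP.
have v0 : v 0 = 0 by rewrite /v !linear0.
have vZ x (r : R) : v (x ** r) = v x * r by rewrite -[x ** r]addr0 vP v0 addr0.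
have vE x : (em : R) * v x = v x by apply: pimE.
have v_em x : v x * (em : R) = 0 by rewrite -vZ Mem v0.
(* Here v = v e + v ep, and the second summand dies because ep R e = 0. This makes x |-> x e
   linear. *)
have v_e x r : v x * r * (e : R) = v x * (e : R) * r * (e : R).
  rewrite [in LHS](rsplit (v x)) v_em add0r !mulrDl.
  by rewrite -[_ * _ * r * _]mulrA -[_ * (ep : R) * r * _]mulrA -[X in _ + X]mulrA (mulrA (ep : R)) ep_e mulr0 addr0 !mulrA.
have gP x : (em : R) * v x * (e : R) \in peirce_pred em e.
  by rewrite in_peirce !mulrA idemP -!mulrA idemP.
have gL : linear (fun x => Peirce (gP x) : infl convex_e E).
  move=> r x y; apply: val_inj; rewrite /= vP mulrDr mulrDl; congr (_ + _).
  by rewrite (mulrA (em : R)) !vE v_e !mulrA -[_ * (e : R) * (e : R)]mulrA idemP.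
pose g : {linear M -> G E} := mklin gL.
have g_surj : surj g.
  move=> y; have [z zE] := pimP noethR (peirce_l (y : peirce em e)).
  have [|x xE] := i_surj z.
    apply: pim_val_inj; rewrite linearZ linear0 zE.
    by rewrite -[LHS]/(peirce_val (y : peirce em e) * (em : R)) -peirce_r -mulrA e_em0 mulr0.
  exists x; apply: val_inj => /=.
  by rewrite /v xE zE peirceE.
have gM : ses (kerm noethR g) M (G E) by apply: ses_ker.
apply: (pdle_ext noethR gM); last exact: pdle_G En.
apply: pdle_leq (pdle_ep _); first exact: noethR.
  by rewrite addSn ltnW // ltnS leq_addr.
move=> k; apply: val_inj; apply: v_inj; rewrite /= vZ.
have k0 : v (ker_val k) * (e : R) = 0.
  by have /eqP/(congr1 (@peirce_val _ em e)) := kerP k; rewrite /= vE.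
by rewrite [RHS]rsplit v_em k0 !add0r.
Qed.

(** The corner em R em inherits a directed unit, so all its modules have dimension at most nm;
    inflation adds the bound for the ring. *)
Lemma pdle_Gm : exists n, forall X : modr (corner em), pdle n (Gm X).
Proof.
have [n Gn] := pdle_Gm_ring; exists (n + nm)%N => X.
apply: (fobj_pdle noethR Gn); apply: (directed_pdle noeth_em).
- by have := directed_cproj convex_em directed_m; apply.
- move=> r; rewrite (_ : cproj em em = 1) ?mulr1 //.
  by apply: val_inj; rewrite /= !idemP.
- move=> x; rewrite (_ : cproj em em = 1) ?scale1r //.
  by apply: val_inj; rewrite /= !idemP.
Qed.

(** As ep R e = 0, the module R e is the sum of em R e and e R e. *)
Lemma fix_ring_retr : retr (fixm e R^c^o) (prodm E (ring_mod (corner e))).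
Proof.
have fmP x : (em : R) * x * (e : R) \in peirce_pred em e.
  by rewrite in_peirce !mulrA idemP -!mulrA idemP.
have gP (y : prodm E (ring_mod (corner e))) :
    (peirce_val (y.1 : peirce em e) + peirce_val (y.2 : peirce e e) : R^c^o)
      \in @fix_pred R e R^c^o.
  rewrite in_fix scalerDr; apply/eqP; congr (_ + _).
    exact: (peirce_r (y.1 : peirce em e)).
  exact: (peirce_r (y.2 : peirce e e)).
have fL : linear (fun x : fixm e R^c^o => Peirce (fmP (fix_val x)) : E).
  move=> s x y; apply: val_inj => /=; rewrite mulrDr mulrDl; congr (_ + _).
  by rewrite mulrA -!mulrA peirce_l peirce_r.
have f'L : linear (fun x : fixm e R^c^o => cproj e (fix_val x) : (corner e)^c^o).
  move=> s x y; apply: val_inj => /=; rewrite mulrDr mulrDl; congr (_ + _).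
  by rewrite mulrA -!mulrA peirce_l peirce_r.
have gL : linear (fun y => Fixm (gP y)).
  move=> s x y; apply: val_inj => /=; rewrite scalerDr addrACA; congr (_ + _).
exists (mklin (pair_linear (mklin fL) (mklin f'L))), (mklin gL) => x.
pose r : R := fix_val x; have re : r * (e : R) = r := fixE x.
have ep_r : (ep : R) * r = 0 by rewrite -re mulrA ep_e.
apply: val_inj; rewrite /= -!mulrA -/r re.
by have := congr1 (fun y => y * r) sum1; rewrite mul1r !mulrDl ep_r addr0.
Qed.

Lemma fin_gen_fix_ring : fin_gen (fixm e R^c^o).
Proof.
have [f [g gK]] := fix_ring_retr.
by apply: (@fin_gen_surj _ _ _ g _ (modr_fin_gen _)) => x; exists (f x).
Qed.

Let F := fixed_part fin_gen_fix_ring.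

Lemma pdle_F_ring : exists n, pdle n (F (ring_mod R)).
Proof.
have [n En] := pdle_E; exists n.
have FE : stable_retract (F (ring_mod R)) (prodm E (ring_mod (corner e))).
  by apply: sr_retr; apply: fix_ring_retr.
apply: pdle_sr FE _ => //.
have ER : ses E (prodm E (ring_mod (corner e))) (ring_mod (corner e)).
  exact: ses_biprod.
apply: (pdle_ext noeth_e ER En).
by apply: proj_pdle => //; apply: proj_ring.
Qed.

Lemma simple_infl (T : modr (corner e)) : simple_module T -> simple_module (G T).
Proof.
move=> [T0 simT]; split=> // V [V0 VP]; apply: (simT V); split=> // s x y Vx Vy.
by have := VP (peirce_val s) x y Vx Vy; rewrite inflE cproj_val.
Qed.

Lemma simple_fix (S : modr R) :
  (forall x : S, x ** e = x) -> simple_module S -> simple_module (fixm e S).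
Proof.
move=> Se [[x x0] simS]; split.
  exists (fixproj e x); apply: contra_neq x0 => /(congr1 val)/= .
  by rewrite Se.
move=> V [V0 VP].
pose W : {pred S} := fun x => `[< exists2 y : fixm e S, y \in V & fix_val y = x >].
have WP (y : fixm e S) : (fix_val y \in W) = (y \in V).
  apply/asboolP/idP => [[z Vz zy]|Vy]; last by exists y.
  by have <- : z = y by apply: val_inj.
have W_closed : submod_closed W.
  split=> [|r u w /asboolP[y Vy <-] /asboolP[z Vz <-]]; apply/asboolP.
    by exists 0.
  (* Since e acts as the identity on S, r acts as e r e. *)
  exists ((cproj e r : (corner e)^c) *: y + z); first exact: VP.
  by rewrite /= -!(actM (R := R)) fixE Se.
have [W0|WT] := simS W W_closed; [left|right] => y; rewrite -WP.
  by rewrite W0 !inE -[0]/(fix_val (0 : fixm e S)) (inj_eq val_inj).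
by rewrite WT.
Qed.

(** The elements killed by em form a submodule because e R em = ep R em = 0, and those fixed by ep
    do because ep R = ep R ep. Simplicity makes each of them 0 or S. *)
Lemma simple_trichotomy (S : modr R) : simple_module S ->
  [\/ forall x : S, x ** e = x, forall x : S, x ** em = x | forall x : S, x ** ep = x].
Proof.
move=> [_ simS].
pose V : {pred S} := fun x => x ** em == 0; pose W : {pred S} := fun x => x ** ep == x.
have inV x : (x \in V) = (x ** em == 0) by [].
have inW x : (x \in W) = (x ** ep == x) by [].
have em_act (x : S) r : x ** r ** em = x ** em ** r ** em.
  rewrite [in LHS](split_act x) !scalerDr !(actM (R := R)) !mulrA e_em ep_em.
  by rewrite !scale0r !addr0.
have ep_act (x : S) r : x ** ep ** r ** ep = x ** ep ** r.
  rewrite [RHS]split_act !(actM (R := R)) !mulrA.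
  by rewrite ep_e ep_em !scale0r !add0r.
have [|V0|VT] := simS V.
- split=> [|r x y]; rewrite !inV ?scaler0 // => /eqP xV /eqP yV.
  by rewrite scalerDr em_act xV !scaler0 yV addr0.
- constructor 2 => x; apply/esym/eqP; rewrite -subr_eq0.
  have : x - x ** em \in V by rewrite inV scalerBr (actM (R := R)) idemP subrr.
  by rewrite V0.
have Vx (x : S) : x ** em = 0 by have := VT x; rewrite inV => /eqP.
have [|W0|WT] := simS W.
- split=> [|r x y]; rewrite !inW ?scaler0 // => /eqP xW /eqP yW.
  by rewrite scalerDr -{1}xW ep_act xW yW.
- constructor 1 => x; rewrite [RHS]split_act Vx add0r.
  have : x ** ep \in W by rewrite inW (actM (R := R)) idemP.
  by rewrite W0 => /eqP->; rewrite addr0.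
by constructor 3 => x; have := WT x; rewrite inW => /eqP.
Qed.

Theorem ddell_alg_corner k :
  finite_enat (ddell_alg k R) <-> finite_enat (ddell_alg k (corner e)).
Proof.
split=> /finite_sup_enat[m mP]; apply/finite_sup_enat.
  have [d Fd] := pdle_F_ring; exists (d + m)%N => _ [T [simT ->]].
  (* T is isomorphic to F (G T) with G T simple over R, and F costs at most d. *)
  have [f [f_inj f_surj]] := fix_infl convex_e T.
  apply: (ddell_iso (X := F (G T)) f_inj f_surj).
  apply: fobj_ddell => //; apply: mP; exists (G T).
  by split=> //; apply: simple_infl.
(* The three entries bound the simple modules on e, em and ep, in this order. *)
have [n Gmn] := pdle_Gm; exists (maxn (np.+1 + m) (maxn n np)) => _ [S [simS ->]].
have le_max a b k' (X : modr R) : (a <= b)%N -> le_enat (ddell k' X) (Fin a) ->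
    le_enat (ddell k' X) (Fin b).
  by case: (ddell _ _) => //= c ab /leq_trans; apply.
case: (simple_trichotomy simS) => Sx.
- have [f [f_inj f_surj]] := infl_fix convex_e Sx.
  have [g g_surj] := linear_bij_inv_surj f_inj f_surj.
  have T_fg : fin_gen (fixm e S).
    by apply/(fin_gen_infl convex_e); apply: fin_gen_surj g_surj (modr_fin_gen S).
  pose T := Modr T_fg.
  apply: (le_max (np.+1 + m)%N); first exact: leq_maxl.
  apply: (ddell_iso (X := G T) f_inj f_surj).
  apply: fobj_ddell => //; first exact: pdle_G_ring.
  by apply: mP; exists T; split=> //; apply: simple_fix Sx simS.
- have [f [f_inj f_surj]] := infl_fix convex_em Sx.
  have [g g_surj] := linear_bij_inv_surj f_inj f_surj.
  have T_fg : fin_gen (fixm em S).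
    by apply/(fin_gen_infl convex_em); apply: fin_gen_surj g_surj (modr_fin_gen S).
  apply: (le_max n); first by rewrite !leq_max leqnn orbT.
  apply: (ddell_iso (X := Gm (Modr T_fg)) f_inj f_surj).
  by apply: pdle_ddell => //; apply: Gmn.
apply: (le_max np); first by rewrite !leq_max leqnn !orbT.
by apply: pdle_ddell => //; apply: pdle_ep.
Qed.

End Trisection.

(** * Finitely spanned rings and path algebras *)

Section SpannedTheory.
Variables (R : pzRingType) (D : R -> Prop).
Local Notation "x ** r" := (((r : R) : R^c) *: x) (at level 40, left associativity).
Hypotheses (D0 : D 0) (D1 : D 1) (DN1 : D (-1)).
Hypothesis DD : forall x y, D x -> D y -> D (x + y).
Hypothesis DM : forall x y, D x -> D y -> D (x * y).

Lemma spanned_mem (M : rmodType R) (s : seq M) y : y \in s -> spanned D s y.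
Proof.
elim: s => //= z s IHs; rewrite inE => /predU1P[->|/IHs sy].
  by exists 1; rewrite scale1r subrr; split=> //; apply: span0.
by exists 0; rewrite scale0r subr0.
Qed.

Lemma spanned_cat (M : rmodType R) (s t : seq M) x y :
  spanned D s x -> spanned D t y -> spanned D (s ++ t) (x + y).
Proof.
elim: s x => [|z s IHs] x /=; first by move->; rewrite add0r.
by move=> [d [Dd sx]] ty; exists d; split=> //; rewrite addrAC; apply: IHs.
Qed.

Lemma spanned_map (M N : rmodType R) (f : {linear M -> N}) (s : seq M) x :
  spanned D s x -> spanned D (map f s) (f x).
Proof.
elim: s x => [|y s IHs] x /=; first by move->; rewrite linear0.
by move=> [d [Dd /IHs sx]]; exists d; rewrite -linearZ -linearB.
Qed.

Lemma spanned_map_inj (M N : rmodType R) (f : {linear M -> N}) (s : seq M) x :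
  injective f -> spanned D (map f s) (f x) -> spanned D s x.
Proof.
move=> f_inj; elim: s x => [|y s IHs] x /=.
  by move=> fx; apply: f_inj; rewrite fx linear0.
by move=> [d [Dd sx]]; exists d; split=> //; apply: IHs; rewrite linearB linearZ.
Qed.

Lemma spannedB (M : rmodType R) (s : seq M) x y :
  spanned D s x -> spanned D s y -> spanned D s (x - y).
Proof.
move=> sx sy; apply: spanD => //; rewrite -scaleN1r.
exact: (@spanZ R M D DM s y (-1)).
Qed.

Hypothesis DV : forall c, D c -> c != 0 -> exists2 c', D c' & c * c' = 1.

(** Gaussian elimination over the scalars D: a D-subspace of a finitely spanned space is finitely
    spanned. *)
Lemma spanned_sub (M : rmodType R) (s : seq M) (N : M -> Prop) :
  (forall x y, N x -> N y -> N (x - y)) ->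
  (forall x r, D r -> N x -> N (x ** r)) ->
  (forall x, N x -> spanned D s x) ->
  exists t, {in t, forall x, N x} /\ forall x, N x -> spanned D t x.
Proof.
elim: s N => [|y s IHs] N NB NZ Ns; first by exists [::].
pose N' x := N x /\ spanned D s x.
have [||x []//|t [tN tP]] := IHs N'.
- by move=> u v [Nu su] [Nv sv]; split; [apply: NB|apply: spannedB].
- by move=> u r Dr [Nu su]; split; [apply: NZ|apply: spanZ].
(* If some w in N has a nonzero coefficient c at y, it serves as pivot and clears that coefficient
   from all of N; otherwise N already lies in the span of the tail. *)
have [[c [w [Dc c0 Nw sw]]]|no_c] :=
    pselect (exists c w, [/\ D c, c != 0, N w & spanned D s (w - y ** c)]).
  exists (w :: t); split=> [x|x Nx].
    by rewrite inE => /predU1P[->//|/tN[]].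
  have [d [Dd sx]] := Ns _ Nx; have [c' Dc' cc'] := DV Dc c0.
  exists (c' * d); split; first exact: DM.
  apply: tP; split; first by apply: NB => //; apply: NZ => //; apply: DM.
  rewrite (_ : x - _ = (x - d *: y) - (w - y ** c) ** (c' * d)).
    by apply: spannedB => //; apply: spanZ => //; apply: DM.
  rewrite scalerBr (actM (R := R)) mulrA cc' mul1r.
  by rewrite opprB addrA subrK.
exists t; split=> [x /tN[] //|x Nx]; apply: tP; split=> //.
have [d [Dd sx]] := Ns _ Nx; have [d0|d0] := eqVneq (d : R) 0.
  by move: sx; rewrite d0 scale0r subr0.
by case: no_c; exists d, x.
Qed.

(** A finitely generated module is finitely spanned over D, hence so is each submodule, and a
    D-spanning list also generates over R. *)
Lemma noetherian_spanned (L : seq R^c^o) :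
  (forall r : R^c^o, spanned D L r) -> noetherian R.
Proof.
move=> LP X M i i_inj; apply/fin_gen_spanned.
have [z zP] := (fin_gen_spanned X).1 (modr_fin_gen X).
have [s sP] : exists s : seq X, forall x, spanned D s x.
  exists (flatten [seq [seq (p : R^c) *: y | p <- L] | y <- z]) => x.
  elim: z x {zP} (zP x) => [|y z IHz] x //= [r [_ /IHz zx]].
  rewrite -[x](subrK (r *: y)) addrC; apply: spanned_cat => //.
  exact: (spanned_map (mklin (regular_linear y)) (LP r)).
have [x y [u <-] [v <-]|x r _ [u <-]|//|t [tN tP]] :=
    @spanned_sub X s (fun x => exists u, i u = x).
- by exists (u - v); rewrite linearB.
- by exists (u ** r); rewrite linearZ.
have [t' tE] : exists t', map i t' = t.
  elim: t tN {tP} => [|x t IHt] tN; first by exists [::].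
  have [|t' <-] := IHt; first by move=> y yt; apply: tN; rewrite inE yt orbT.
  by have [u <-] := tN x (mem_head _ _); exists (u :: t').
exists t' => u; apply: (spanW (D := D)) => //.
by apply: (spanned_map_inj i_inj); rewrite tE; apply: tP; exists u.
Qed.

End SpannedTheory.

(** * Vertex idempotents and paths in the quotient algebra *)

Section PathAlgebra.
Variables (K : fieldType) (Q : quiver) (I : ideal (path_alg K Q)).
Local Notation A := (path_alg K Q).
Local Notation R := (quot_ring I).
Implicit Types (p q : qpath Q) (S T : {set vertex Q}) (v w : vertex Q) (x y : A).

Definition eltsum S : A := \sum_(v in S) pelt K (ptriv v).

Lemma mulE x y : x * y = path_mul x y. Proof. by []. Qed.

Lemma mulZl (c : K) x y : (c *: x) * y = c *: (x * y).
Proof. by rewrite -[LHS]/(path_mulr y (c *: x)) linearZ. Qed.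

Lemma mulZr (c : K) x y : x * (c *: y) = c *: (x * y).
Proof. by rewrite -[LHS]/(path_mul x (c *: y)) linearZ. Qed.

Lemma eltsum_mul S p : eltsum S * pelt K p = if psrc p \in S then pelt K p else 0.
Proof.
rewrite mulr_suml; case: ifP => [pS|pS].
  rewrite (bigD1 (psrc p)) //= big1 => [|v /andP[_ ne]].
    by rewrite addr0 mulE path_mulU /pelt_mul pcomp1p eqxx.
  by rewrite mulE path_mulU /pelt_mul pcomp1p (negPf ne).
apply: big1 => v vS; rewrite mulE path_mulU /pelt_mul pcomp1p.
by case: eqP => // vp; rewrite -vp vS in pS.
Qed.

Lemma mul_eltsum S p : pelt K p * eltsum S = if ptgt p \in S then pelt K p else 0.
Proof.
rewrite mulr_sumr; case: ifP => [pS|pS].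
  rewrite (bigD1 (ptgt p)) //= big1 => [|v /andP[_ ne]].
    by rewrite addr0 mulE path_mulU /pelt_mul pcompp1 eqxx.
  by rewrite mulE path_mulU /pelt_mul pcompp1 (negPf ne).
apply: big1 => v vS; rewrite mulE path_mulU /pelt_mul pcompp1.
by case: eqP => // vp; rewrite -vp vS in pS.
Qed.

(** Multiplying by the two idempotents keeps exactly the paths of y from S to T. *)
Lemma eltsum_ind S T (P : A -> Prop) :
  P 0 -> (forall y z, P y -> P z -> P (y + z)) ->
  (forall c p, psrc p \in S -> ptgt p \in T -> P (c *: pelt K p)) ->
  forall y, P (eltsum S * y * eltsum T).
Proof.
move=> P0 PD PZ y.
have -> x z : x * y * z = \sum_(p <- finmap.enum_fset (msupp y)) x * (mcoeff p y *: pelt K p) * z.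
  by rewrite {1}[y]pelt_span mulr_sumr mulr_suml.
apply: (big_ind P P0 PD) => p _; rewrite mulZr mulZl eltsum_mul.
case: ifP => pS; last by rewrite mul0r scaler0.
by rewrite mul_eltsum; case: ifP => pT; [apply: PZ|rewrite scaler0].
Qed.

Lemma vertex_sumE S : vertex_sum I S = quot_proj I (eltsum S).
Proof. by rewrite /vertex_sum /eltsum rmorph_sum. Qed.

Lemma quot_surj (r : R) : exists y, quot_proj I y = r.
Proof. by elim/generic_quotient.quotW: r => y; exists y. Qed.

Lemma quot_mulE x y : quot_proj I x * quot_proj I y = quot_proj I (x * y).
Proof. by rewrite rmorphM. Qed.

Lemma vertex_sum_zero S T (r : R) :
  (forall p, psrc p \in S -> ptgt p \in T -> False) ->
  vertex_sum I S * r * vertex_sum I T = 0.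
Proof.
move=> noP; have [y <-] := quot_surj r; rewrite !vertex_sumE !quot_mulE.
rewrite -[RHS](rmorph0 (quot_proj I)); congr quot_proj.
apply: (eltsum_ind (P := fun z => z = 0)) => // [u w -> ->|c p pS pT].
  exact: addr0.
by case: (noP p).
Qed.

Lemma vertex_sum_disj S T : [disjoint S & T] -> vertex_sum I S * vertex_sum I T = 0.
Proof.
move=> ST; rewrite !vertex_sumE quot_mulE -[RHS](rmorph0 (quot_proj I)); congr quot_proj.
rewrite {2}/eltsum mulr_sumr; apply: big1 => v vT.
by rewrite eltsum_mul /= -[psrc _]/v (disjointFl ST vT).
Qed.

Lemma vertex_sumU S T : [disjoint S & T] ->
  vertex_sum I (S :|: T) = vertex_sum I S + vertex_sum I T.
Proof. by move=> ST; rewrite /vertex_sum (eq_bigl [predU S & T]) ?bigU // => v; rewrite !inE. Qed.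

Lemma vertex_sum1 : vertex_sum I [set: vertex Q] = 1.
Proof.
rewrite vertex_sumE -[RHS](rmorph1 (quot_proj I)); congr quot_proj.
by apply: eq_bigl => v; rewrite inE.
Qed.

Lemma cycle_on p : (0 < plen p)%N -> psrc p = ptgt p -> on_cycle (psrc p).
Proof. by move=> p0 pp; exists p; split=> //; apply: mem_head. Qed.

Lemma plen0 p : plen p = 0%N -> p = ptriv (psrc p).
Proof. by move=> /size0nil p0; apply: qpath_eq. Qed.

Lemma pcomp_ex p q : ptgt p = psrc q ->
  exists r, [/\ psrc r = psrc p, ptgt r = ptgt q, plen r = (plen p + plen q)%N
    & ptgt p \in pverts r].
Proof.
move=> /pcomp_some[r [_ rs rt ra]]; exists r; split; rewrite // ?/plen ?ra ?size_cat //.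
by rewrite /pverts rs ra map_cat -cat_cons mem_cat mem_last.
Qed.

(** The only path from an acyclic v to itself is trivial, so the corner at v consists of scalar
    multiples of its idempotent; the inverse is given by c^-1. *)
Lemma vertex_sum_div v (r : R) : ~ on_cycle v ->
  let a := vertex_sum I [set v] in
  a * r * a != 0 -> exists t, a * r * a * (a * t * a) = a.
Proof.
move=> v_acyclic a; have [y yE] := quot_surj r.
pose z := pelt K (ptriv v).
have zE : eltsum [set v] = z by rewrite /eltsum big_set1.
have zz : z * z = z by rewrite -{1}zE eltsum_mul set11.
have zZz d : z * (d *: z) * z = d *: z.
  have zZ : z * (d *: z) = d *: z := etrans (mulZr d z z) (congr1 ( *:%R d) zz).
  exact: etrans (congr1 ( *%R^~ z) zZ) (etrans (mulZl d z z) (congr1 ( *:%R d) zz)).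
have [c cE] : exists c : K, z * y * z = c *: z.
  rewrite -zE; apply: (eltsum_ind (P := fun x => exists c : K, x = c *: eltsum [set v]))
      => [|u w [c ->] [d ->]|c p].
  - by exists 0; rewrite scale0r.
  - by exists (c + d); rewrite scalerDl.
  rewrite !inE => /eqP ps /eqP pt; exists c; rewrite zE; congr (_ *: pelt _ _).
  rewrite -ps; apply: plen0; apply/eqP; rewrite -leqn0 leqNgt; apply/negP => p0.
  by apply: v_acyclic; rewrite -ps; apply: cycle_on; rewrite ?ps ?pt.
have aE : a = quot_proj I z by rewrite /a vertex_sumE zE.
have azaE x : a * quot_proj I x * a = quot_proj I (z * x * z).
  by rewrite aE (quot_mulE z x) (quot_mulE (z * x) z).
have araE : a * r * a = quot_proj I (c *: z) by rewrite -yE azaE cE.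
move=> ne0; have c0 : c != 0.
  by apply: contraNneq ne0 => c0; rewrite [a * r * a]araE c0 scale0r rmorph0.
exists (quot_proj I (c^-1 *: z)).
have atE := etrans (azaE (c^-1 *: z)) (congr1 _ (zZz c^-1)).
refine (etrans (congr1 ( *%R^~ (a * quot_proj I (c^-1 *: z) * a)) araE) _).
refine (etrans (congr1 ( *%R (quot_proj I (c *: z))) atE) _).
refine (etrans (quot_mulE _ _) _); rewrite aE; congr quot_proj.
refine (etrans (mulZl c z _) (etrans (congr1 ( *:%R c) (mulZr c^-1 z z)) _)).
by rewrite zz scalerA divff ?c0 ?scale1r.
Qed.

(** A vertex v of S with the most reachable vertices receives no path from the rest of S, so its
    idempotent can be split off first. *)
Lemma directed_acyclic S : {in S, forall v, ~ on_cycle v} ->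
  directed #|S| (vertex_sum I S).
Proof.
move: {-1}#|S| (erefl #|S|) => n; elim: n S => [|n IHn] S.
  move=> S0 _; rewrite (cards0_eq S0) /vertex_sum big_set0; exact: Directed0.
move=> cardS S_acyclic; have [v0 v0S] : exists v, v \in S.
  by apply/set0Pn; rewrite -card_gt0 cardS.
pose reach u := [set w | `[< exists p, psrc p = u /\ ptgt p = w >]].
case: (arg_maxnP (fun u => #|reach u|) v0S) => v v_in_S vmax.
have vS : v \in S := v_in_S.
have no_path p : psrc p \in S :\ v -> ptgt p \in [set v] -> False.
  rewrite !inE => /andP[pv pS] /eqP pt.
  (* The source of a path into v reaches all that v reaches, and also itself; v cannot reach it
     without closing a cycle. *)
  suff: (#|reach v| < #|reach (psrc p)|)%N by rewrite ltnNge [X in ~~ X](vmax _ pS).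

    apply: proper_card; apply/properP; split.
      apply/subsetP => w; rewrite !inE => /asboolP[q [qs qt]]; apply/asboolP.
      have [|r [rs rt _ _]] := @pcomp_ex p q; first by rewrite pt qs.
      by exists r; rewrite rs rt.
    exists (psrc p); first by rewrite inE; apply/asboolP; exists (ptriv (psrc p)).
    rewrite inE; apply/asboolP => -[q [qs qt]].
    have [|r [rs rt rl _]] := @pcomp_ex p q; first by rewrite pt qs.
    apply: (S_acyclic _ pS); rewrite -rs; apply: cycle_on; last by rewrite rs rt qt.
    rewrite rl addn_gt0; apply/orP; left; rewrite lt0n; apply: contraNneq pv => /plen0 pE.
    by rewrite -pt [in ptgt p]pE.
have dS : [disjoint [set v] & S :\ v] by rewrite disjoints1 !inE eqxx.
rewrite -(setD1K vS) vertex_sumU //; apply: DirectedS.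
- exact: vertex_sum_idem.
- exact: vertex_sum_idem.
- exact: vertex_sum_disj.
- by move=> r; apply: vertex_sum_zero => p; apply: no_path.
- by move=> r; apply: vertex_sum_div; apply: S_acyclic.
apply: IHn; last by move=> u; rewrite inE => /andP[_ /S_acyclic].
by move: cardS; rewrite (cardsD1 v S) vS => -[].
Qed.

Fixpoint words (n : nat) : seq (seq (arrow Q)) :=
  if n is m.+1 then
    [::] :: flatten [seq [seq a :: s | s <- words m] | a <- enum (arrow Q)]
  else [:: [::]].

Lemma mem_words n (s : seq (arrow Q)) : (size s <= n)%N -> s \in words n.
Proof.
elim: n s => [|n IHn] [|a s] //= sn; rewrite inE /=.
apply/flattenP; exists [seq a :: s | s <- words n]; last first.
  by apply/mapP; exists s => //; apply: IHn.
by apply/mapP; exists a => //; rewrite mem_enum.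
Qed.

Definition short_paths n : seq (qpath Q) :=
  pmap insub (flatten [seq [seq (v, s) | s <- words n] | v <- enum (vertex Q)]).

Lemma mem_short_paths n p : (plen p <= n)%N -> p \in short_paths n.
Proof.
move=> pn; rewrite mem_pmap_sub; apply/flattenP.
exists [seq (psrc p, s) | s <- words n].
  by apply/mapP; exists (psrc p) => //; rewrite mem_enum.
apply/mapP; exists (parrows p); first exact: mem_words.
exact: surjective_pairing.
Qed.

Lemma long_path_in p m : (m <= plen p)%N -> ideal_pow (@arrow_ideal K Q) m (pelt K p).
Proof.
elim: m p => [|m IHm] [[v [|a s]] w] //= sm; move=> J; apply.
have /= /andP[/eqP av w'] := w.
pose q : qpath Q := @QPath Q (tgt a, s) w'.
exists (pelt K (parrow a)), (pelt K q); split; first by move=> J'; apply; exists a.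
  exact: IHm.
rewrite mulE path_mulU /pelt_mul; have [|r [-> rs _ ra]] := @pcomp_some Q (parrow a) q.
  by [].
congr pelt; apply: qpath_eq; first by rewrite rs /psrc /= av.
by rewrite ra.
Qed.

Lemma quot_proj0 x : x \in I -> quot_proj I x = 0.
Proof.
move=> xI; rewrite -[RHS](rmorph0 (quot_proj I)); apply/eqP.
by rewrite -[_ == _]/(_ == _ %[mod _])%qT -Quotient.idealrBE subr0.
Qed.

(** Paths of length at least m vanish in the quotient, so it is spanned over the image D of K by the
    finitely many paths of length at most m. *)
Lemma noetherian_quot : admissible I -> noetherian R.
Proof.
move=> [m [_ Im _]]; pose scal (c : K) : R := quot_proj I (c *: (1 : A)).
have scalM c d : scal c * scal d = scal (c * d).
  by rewrite quot_mulE mulZl mul1r scalerA.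
have scal1 : scal 1 = 1 by rewrite /scal scale1r rmorph1.
have scal0 : scal 0 = 0 by rewrite /scal scale0r rmorph0.
have scalZ c x : quot_proj I (c *: x) = quot_proj I x * scal c.
  by rewrite quot_mulE mulZr mulr1.
pose D (r : R) := exists c : K, r = scal c.
have D0 : D 0 by exists 0.
have D1 : D 1 by exists 1.
have DN1 : D (-1) by exists (-1); rewrite /scal scaleN1r rmorphN rmorph1.
have DD r s : D r -> D s -> D (r + s).
  by move=> [c ->] [d ->]; exists (c + d); rewrite /scal scalerDl rmorphD.
have DM r s : D r -> D s -> D (r * s).
  by move=> [c ->] [d ->]; exists (c * d).
have DV r : D r -> r != 0 -> exists2 s, D s & r * s = 1.
  move=> [c ->] ne0; have c0 : c != 0 by apply: contraNneq ne0 => ->; rewrite scal0.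
  by exists (scal c^-1); [exists c^-1|rewrite scalM divff].
pose L := [seq (quot_proj I (pelt K p) : R^c^o) | p <- short_paths m].
have path_spanned c p : spanned D L (quot_proj I (c *: pelt K p) : R^c^o).
  rewrite scalZ; have [pm|/ltnW pm] := leqP (plen p) m.
    apply: spanZ => //; first by exists c.
    by apply: spanned_mem => //; apply: map_f; apply: mem_short_paths.
  rewrite quot_proj0 ?mul0r; first exact: span0.
  by apply: Im; apply: long_path_in.
refine (noetherian_spanned DN1 DD DM DV (L := L) _) => r.
have [y <-] := quot_surj r; rewrite [y]pelt_span.
apply: (big_ind (fun x => spanned D L (quot_proj I x : R^c^o))) => [|u w Lu Lw|p _].
- by rewrite rmorph0; apply: span0.
- by rewrite rmorphD; apply: spanD.
exact: path_spanned.
Qed.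

End PathAlgebra.

(** * Convexity of the heart and the direction of paths around it *)

Section Heart.
Variable Q : quiver.
Implicit Types (p q : qpath Q) (v : vertex Q).

Definition heart_plus : {set vertex Q} := ~: (heart_minus Q :|: heart Q).

Lemma heart_plus_path p : psrc p \in heart_plus -> ptgt p \notin heart Q.
Proof.
rewrite !inE => /norP[ps_minus ps_heart]; apply: contra ps_minus => pt.
by rewrite ps_heart; apply/asboolP; exists p; rewrite inE.
Qed.

Lemma pverts_split p v : v \in pverts p -> exists q r,
  [/\ psrc q = psrc p, ptgt q = v, psrc r = v & ptgt r = ptgt p].
Proof.
case: p => -[x s] w; rewrite /pverts /psrc /parrows /= => vs.
have [s1 [s2 [sE vE]]] : exists s1 s2, s = s1 ++ s2 /\ last x (map (@tgt Q) s1) = v.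
  elim: s x vs {w} => [|a s IHs] x /=.
    by rewrite mem_seq1 => /eqP->; exists [::], [::].
  rewrite inE => /predU1P[->|/IHs[s1 [s2 [-> vE]]]]; first by exists [::], (a :: s).
  by exists (a :: s1), s2.
have /andP[w1 w2] : is_walk x s1 && is_walk v s2.
  by move: (w); rewrite /= {1}sE is_walk_cat vE.
exists (@QPath Q (x, s1) w1), (@QPath Q (v, s2) w2); split=> //.
by rewrite /ptgt /psrc /parrows /= sE map_cat last_cat vE.
Qed.

(** Extend p q backwards to a vertex on a cycle and forwards to another one; the resulting path
    passes through the end of p. *)
Lemma heart_convex p q : psrc p \in heart Q -> ptgt p = psrc q ->
  ptgt q \in heart Q -> ptgt p \in heart Q.
Proof.
rewrite !inE => /asboolP[r [rs _ /pverts_split[r1 [_ [r1s r1t _ _]]]]] pq.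
move=> /asboolP[r' [_ r't /pverts_split[_ [r2 [_ _ r2s r2t]]]]].
have [a [as_ at_ _ _]] := pcomp_ex r1t.
have [b [bs bt _ _]] := pcomp_ex (esym r2s).
have [|c [cs ct _ cv]] := @pcomp_ex Q a b; first by rewrite at_ bs.
by apply/asboolP; exists c; rewrite cs ct as_ bt r1s r2t -at_.
Qed.

(** A path from the heart into H^- could be continued back to the heart, and convexity would put its
    end in the heart. *)
Lemma heart_minus_path p : psrc p \in heart Q -> ptgt p \notin heart_minus Q.
Proof.
move=> ps; rewrite inE negb_and negbK; apply/orP.
have [pt|npt] := boolP (ptgt p \in heart Q); [by left|right].
by apply/asboolP => -[q [qs qt]]; case/negP: npt; apply: heart_convex qt.
Qed.

Lemma heart_plus_minus p : psrc p \in heart_plus -> ptgt p \notin heart_minus Q.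
Proof.
move=> ps; rewrite inE negb_and; apply/orP; right.
apply/asboolP => -[q [qs qt]]; have [r [rs rt _ _]] := pcomp_ex (esym qs).
by have := @heart_plus_path r; rewrite rs rt qt => /(_ ps).
Qed.

Lemma notin_heart v : v \notin heart Q -> ~ on_cycle v.
Proof.
move=> vH v_cycle; case/negP: vH; rewrite inE; apply/asboolP.
by exists (ptriv v); split; rewrite //= mem_head.
Qed.

End Heart.

Theorem corollary5p9 (K : fieldType) (Q : quiver) (I : ideal (path_alg K Q))
    (e := vertex_idem I (heart Q))
    (e_minus := vertex_idem I (heart_minus Q)) :
  admissible I ->
  finite_enat (pd (peirce_mod e_minus e : rmodType (corner e))) ->
  forall k : nat, (1 <= k)%N ->
    finite_enat (ddell_alg k (quot_ring I))
    <-> finite_enat (ddell_alg k (corner e)).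
Proof.
move=> admI pd_finite k _.
have acyclic_minus : {in heart_minus Q, forall v, ~ on_cycle v}.
  by move=> v; rewrite inE => /andP[/notin_heart].
have acyclic_plus : {in heart_plus Q, forall v, ~ on_cycle v}.
  by move=> v; rewrite !inE => /norP[_ vH]; apply: notin_heart; rewrite inE.
have disj : [disjoint heart_minus Q & heart Q].
  by rewrite disjoint_subset; apply/subsetP => v; rewrite !inE => /andP[].
(* The remaining goals are the decomposition of 1 and three vanishing products, which express the
   absence of paths from H to H^-, from H^+ to H and from H^+ to H^-. *)
refine (@ddell_alg_corner _ e_minus e (vertex_idem I (heart_plus Q))
  (noetherian_quot admI) _ _ _ _ _ _ (directed_acyclic I acyclic_minus)
  (directed_acyclic I acyclic_plus) pd_finite k).
- rewrite /= -vertex_sumU // -vertex_sumU ?setUCr ?vertex_sum1 //.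
  by rewrite -subsets_disjoint.
- by move=> r; apply: vertex_sum_zero => p /heart_minus_path/negP.
- by move=> r; apply: vertex_sum_zero => p /heart_plus_path/negP.
- by move=> r; apply: vertex_sum_zero => p /heart_plus_minus/negP.
Qed.
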